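(* Let $N(B)$ denote the number of vectors $\mathbf{x}=(x_0,x_1,x_2,x_3)\in\mathbb{Z}^4$ with $\gcd(x_0,x_1,x_2,x_3)=1$, such that \[x_0^3+x_1^3+x_2^3+x_3^3=0,\] such that $\mathbf{x}$ does not lie on any of the three lines \[x_0+x_1=x_2+x_3=0,\qquad x_0+x_2=x_1+x_3=0,\qquad x_0+x_3=x_1+x_2=0,\] and such that $\max_i|x_i|\le B$. Then there is an absolute constant $c>0$ such that \[N(B)\ge c\, B(\log B)^3\] for all $B\ge 6$. *)

(* Defs.v *)
From HB Require Import structures.
From mathcomp Require Import all_boot all_order all_algebra.
From mathcomp Require Import finmap.
From mathcomp Require Import all_classical all_reals all_analysis.

Set Implicit Arguments.
Unset Strict Implicit.
Unset Printing Implicit Defensive.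

Import Order.TTheory GRing.Theory Num.Theory.

Local Open Scope classical_set_scope.
Local Open Scope ring_scope.

Definition primitive_vec (x : 'rV[int]_4) : Prop :=
  \big[gcdn/0%N]_(i < 4) absz (x 0 i) = 1%N.

(* The numerals 2 and 3 used as indices are taken in 'I_4 = Z/4Z, where they
   denote the third and fourth coordinates. *)
Definition on_fermat_cubic (x : 'rV[int]_4) : Prop :=
  x 0 0 ^+ 3 + x 0 1 ^+ 3 + x 0 2 ^+ 3 + x 0 3 ^+ 3 = 0.

Definition on_line01 (x : 'rV[int]_4) : Prop :=
  x 0 0 + x 0 1 = 0 /\ x 0 2 + x 0 3 = 0.

Definition on_line02 (x : 'rV[int]_4) : Prop :=
  x 0 0 + x 0 2 = 0 /\ x 0 1 + x 0 3 = 0.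

Definition on_line03 (x : 'rV[int]_4) : Prop :=
  x 0 0 + x 0 3 = 0 /\ x 0 1 + x 0 2 = 0.

Definition height (x : 'rV[int]_4) : nat := (\max_(i < 4) absz (x 0%R i))%N.

Definition solutions (R : realType) (B : R) : set 'rV[int]_4 :=
  [set x | [/\ primitive_vec x, on_fermat_cubic x,
               [/\ ~ on_line01 x, ~ on_line02 x & ~ on_line03 x]
             & (height x)%:R <= B]].

(* fset_set returns the empty set on infinite sets; by this lemma that default
   is never used in num_solutions below. *)
Lemma finite_solutions (R : realType) (B : R) : finite_set (solutions B).
Proof.
pose M := Num.truncn B.
pose f (A : 'M['I_(M + M).+1]_(1, 4)) : 'rV[int]_4 :=
  \row_j ((A 0 j)%:Z - M%:Z).
apply: (@sub_finite_set _ _ (f @` setT)); last first.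
  by apply: finite_image; exact: finite_finset.
move=> x [_ _ _ hx].
have hM (j : 'I_4) : (absz (x 0%R j) <= M)%N.
  have /leq_trans -> // : (absz (x 0%R j) <= height x)%N.
    exact: (@leq_bigmax _ (fun i : 'I_4 => absz (x 0%R i)) j).
  by rewrite truncn_ge_nat //; apply: le_trans hx.
exists (\row_j inord (absz (x 0 j + M%:Z))) => //.
apply/rowP => j; rewrite !mxE.
have xM : `|x 0 j| <= M%:Z by rewrite -abszE lez_nat; exact: hM.
have := xM; rewrite ler_norml => /andP[x1 x2].
have x0 : 0 <= x 0 j + M%:Z by rewrite -lerBlDr sub0r.
rewrite inordK; first by rewrite gez0_abs // addrK.
by rewrite ltnS -lez_nat gez0_abs // PoszD lerD2r.
Qed.

Definition num_solutions (R : realType) (B : R) : nat := #|` fset_set (solutions B)|.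

(* Main.v *)
Require Import Defs.
From HB Require Import structures.
From mathcomp Require Import all_boot all_order all_algebra.
From mathcomp Require Import finmap.
From mathcomp Require Import all_classical all_reals all_analysis.
From mathcomp Require Import zify ring lra.
Import Order.TTheory GRing.Theory Num.Theory.
Local Open Scope ring_scope.

Set Implicit Arguments.
Unset Strict Implicit.
Unset Printing Implicit Defensive.

(* Write O = Z[w] with w^2 + w + 1 = 0, N for its norm, a = x0 + w x1 and
   b = - x2 - w x3.  The equation says (x0 + x1) N(a) = - (x2 + x3) N(b), and
   x0 + x1, - x2 - x3 are the same linear form in a and in b; hence [a : b] = z
   determines the point, and for z = [u : v] the solution is Euler's
     (a, b) = (1 - w) (nu / m) (u, v),  nu = u^* N(u) - v^* N(v),
   for any integer m dividing nu.  The points with u, v of size U have height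
   about U^4 / m, so one wants many (u, v) for which nu has a large content.

   Three independent families of divisors of nu are used: n = N(eta) when
   u = eta A and v = eta^* C; an integer d1 with v = u modulo d1; and
   e = N(delta) with v = r u modulo e, where r is the primitive cube root of
   unity modulo e attached to delta.  For given (d1, delta, eta) the pairs
   (u, v) form a lattice of index (d1 e n)^2, so a box of side about
   (B d1 e n)^(1/4) contains about B / (d1 e n) of them, and summing over
   d1, delta, eta of size at most a small power of B gives B (log B)^3.

   The data can be recovered from the point once d1, e, n are squarefree, the
   relevant norms are coprime, and no further prime p <= P admits a cube root of
   unity r with v = r u modulo p.  A union bound over primes shows that a
   positive proportion of each dyadic box satisfies these conditions: all data
   are fixed modulo W, so that only primes p > P0 matter, and each bad event
   has density O(1 / p^2). *)

(** * Eisenstein integers *)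

(* [Eis a b] is a + b w. *)
Record eis := Eis { re : int; om : int }.
Definition eis_pair z := (re z, om z).
Definition pair_eis (t : int * int) := Eis t.1 t.2.
Lemma eis_pairK : cancel eis_pair pair_eis. Proof. by case. Qed.
HB.instance Definition _ := Equality.copy eis (can_type eis_pairK).
HB.instance Definition _ := Choice.copy eis (can_type eis_pairK).

Definition eadd z t := Eis (re z + re t) (om z + om t).
Definition eopp z := Eis (- re z) (- om z).
Definition emul z t :=
  Eis (re z * re t - om z * om t) (re z * om t + om z * re t - om z * om t).

Lemma eaddA : associative eadd.
Proof. by move=> [a b] [c d] [e f]; rewrite /eadd /= !addrA. Qed.
Lemma eaddC : commutative eadd.
Proof. by move=> [a b] [c d]; rewrite /eadd /= addrC [b + _]addrC. Qed.
Lemma eadd0 : left_id (Eis 0 0) eadd.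
Proof. by move=> [a b]; rewrite /eadd /= !add0r. Qed.
Lemma eaddN : left_inverse (Eis 0 0) eopp eadd.
Proof. by move=> [a b]; rewrite /eadd /= !addNr. Qed.
HB.instance Definition _ := GRing.isZmodule.Build eis eaddA eaddC eadd0 eaddN.

Lemma emulA : associative emul.
Proof. by move=> [a b] [c d] [e f]; rewrite /emul /=; congr Eis; ring. Qed.
Lemma emulC : commutative emul.
Proof. by move=> [a b] [c d]; rewrite /emul /=; congr Eis; ring. Qed.
Lemma emul1 : left_id (Eis 1 0) emul.
Proof. by move=> [a b]; rewrite /emul /=; congr Eis; ring. Qed.
Lemma emulD : left_distributive emul eadd.
Proof. by move=> [a b] [c d] [e f]; rewrite /emul /eadd /=; congr Eis; ring. Qed.
Lemma eis1_neq0 : Eis 1 0 != 0.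
Proof. by []. Qed.
HB.instance Definition _ :=
  GRing.Zmodule_isComNzRing.Build eis emulA emulC emul1 emulD eis1_neq0.

Lemma eis_eq z t : re z = re t -> om z = om t -> z = t.
Proof. by case: z t => a b [c d] /= -> ->. Qed.

Lemma re0 : re 0 = 0. Proof. by []. Qed.
Lemma om0 : om 0 = 0. Proof. by []. Qed.
Lemma re1 : re 1 = 1. Proof. by []. Qed.
Lemma om1 : om 1 = 0. Proof. by []. Qed.
Lemma reD z t : re (z + t) = re z + re t. Proof. by []. Qed.
Lemma omD z t : om (z + t) = om z + om t. Proof. by []. Qed.
Lemma reN z : re (- z) = - re z. Proof. by []. Qed.
Lemma omN z : om (- z) = - om z. Proof. by []. Qed.
Lemma reM z t : re (z * t) = re z * re t - om z * om t. Proof. by []. Qed.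
Lemma omM z t : om (z * t) = re z * om t + om z * re t - om z * om t.
Proof. by []. Qed.

Lemma eis_intr (k : int) : k%:~R = Eis k 0.
Proof.
have nat_case (n : nat) : (n%:Z)%:~R = Eis n%:Z 0.
  elim: n => [//|n IHn].
  by rewrite -addn1 PoszD intrD IHn; apply: eis_eq; rewrite ?reD ?omD.
case: k => n; first exact: nat_case.
by rewrite NegzE mulrNz nat_case; apply: eis_eq; rewrite ?reN ?omN ?oppr0.
Qed.
Lemma re_intr (k : int) : re k%:~R = k. Proof. by rewrite eis_intr. Qed.
Lemma om_intr (k : int) : om k%:~R = 0. Proof. by rewrite eis_intr. Qed.

(** Complex conjugation, which sends w to w^2 = -1 - w. *)
Definition conj z := Eis (re z - om z) (- om z).
Lemma re_conj z : re (conj z) = re z - om z. Proof. by []. Qed.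
Lemma om_conj z : om (conj z) = - om z. Proof. by []. Qed.
Definition eisE := (reD, omD, reN, omN, reM, omM, re_intr, om_intr, re_conj,
  om_conj, re0, om0, re1, om1).

Definition norm z : int := re z ^+ 2 - re z * om z + om z ^+ 2.

Lemma conjM z t : conj (z * t) = conj z * conj t.
Proof. by apply: eis_eq; rewrite !eisE; ring. Qed.
Lemma conjB z t : conj (z - t) = conj z - conj t.
Proof. by apply: eis_eq; rewrite !eisE; ring. Qed.
Lemma conjK z : conj (conj z) = z.
Proof. by apply: eis_eq; rewrite !eisE; ring. Qed.
Lemma conj_intr (k : int) : conj k%:~R = k%:~R.
Proof. by apply: eis_eq; rewrite !eisE; ring. Qed.
Lemma mul_conj z : z * conj z = (norm z)%:~R.
Proof. by apply: eis_eq; rewrite !eisE /norm; ring. Qed.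
Lemma normM z t : norm (z * t) = norm z * norm t.
Proof. by rewrite /norm !eisE; ring. Qed.
Lemma norm_conj z : norm (conj z) = norm z.
Proof. by rewrite /norm !eisE; ring. Qed.
Lemma norm_intr (k : int) : norm k%:~R = k ^+ 2.
Proof. by rewrite /norm !eisE; ring. Qed.
Lemma norm4 z : 4 * norm z = (2 * re z - om z) ^+ 2 + 3 * om z ^+ 2.
Proof. by rewrite /norm; ring. Qed.
Lemma norm4' z : 4 * norm z = (2 * om z - re z) ^+ 2 + 3 * re z ^+ 2.
Proof. by rewrite /norm; ring. Qed.
Lemma norm_ge0 z : 0 <= norm z.
Proof.
have := norm4 z; have := sqr_ge0 (2 * re z - om z); have := sqr_ge0 (om z); lia.
Qed.
Lemma norm_eq0 z : norm z = 0 -> z = 0.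
Proof.
move=> h; have h1 := norm4 z; have h2 := norm4' z; rewrite h in h1 h2.
have := sqr_ge0 (2 * re z - om z); have := sqr_ge0 (om z).
have := sqr_ge0 (2 * om z - re z); have := sqr_ge0 (re z) => p1 p2 p3 p4.
by apply: eis_eq; rewrite ?re0 ?om0; apply/eqP; rewrite -sqrf_eq0; apply/eqP; lia.
Qed.
Lemma norm0 : norm 0 = 0. Proof. by []. Qed.

Lemma eis_mulf_eq0 (z t : eis) : z * t = 0 -> z = 0 \/ t = 0.
Proof.
move=> h; have := normM z t; rewrite h norm0 => /esym/eqP.
by rewrite mulf_eq0 => /orP[] /eqP /norm_eq0; [left|right].
Qed.
Lemma eis_mulfI (z t w : eis) : z != 0 -> z * t = z * w -> t = w.
Proof.
move=> z0 h; have : z * (t - w) = 0 by rewrite mulrBr h subrr.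
by move=> /eis_mulf_eq0[/eqP|/eqP]; [rewrite (negbTE z0)|rewrite subr_eq0 => /eqP].
Qed.
Lemma eis_intr_eq0 (k : int) : (k%:~R == 0 :> eis) = (k == 0).
Proof.
apply/eqP/eqP => [|->]; last by [].
by move/(congr1 re); rewrite !eisE.
Qed.

Definition edvd (m : int) z := (m %| re z)%Z && (m %| om z)%Z.

Lemma edvdP (m : int) z : reflect (exists w, z = m%:~R * w) (edvd m z).
Proof.
apply: (iffP andP) => [[/dvdzP[a ha] /dvdzP[b hb]]|[w ->]].
  by exists (Eis a b); apply: eis_eq; rewrite !eisE /= ?ha ?hb; ring.
by rewrite !eisE !mul0r subr0 addr0 subr0 !dvdz_mulr.
Qed.
Lemma edvdMl m t z : edvd m z -> edvd m (t * z).
Proof. by move/edvdP => [w ->]; apply/edvdP; exists (t * w); ring. Qed.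
Lemma edvdMr m t z : edvd m z -> edvd m (z * t).
Proof. by rewrite mulrC; exact: edvdMl. Qed.
Lemma edvdD m t z : edvd m t -> edvd m z -> edvd m (t + z).
Proof.
move=> /edvdP[a ->] /edvdP[b ->]; apply/edvdP; exists (a + b); ring.
Qed.
Lemma edvdB m t z : edvd m t -> edvd m z -> edvd m (t - z).
Proof.
move=> /edvdP[a ->] /edvdP[b ->]; apply/edvdP; exists (a - b); ring.
Qed.
Lemma edvd_conj m z : edvd m z -> edvd m (conj z).
Proof.
move/edvdP => [w ->]; apply/edvdP; exists (conj w).
by rewrite conjM conj_intr.
Qed.
Lemma edvd_intr m (k : int) : edvd m k%:~R = (m %| k)%Z.
Proof. by rewrite /edvd !eisE dvdz0 andbT. Qed.
Lemma edvd_trans k m z : (k %| m)%Z -> edvd m z -> edvd k z.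
Proof. by move=> h /andP[h1 h2]; rewrite /edvd !(dvdz_trans h). Qed.
Lemma edvd_Gauss_intr (m k : int) z :
  coprimez m k -> edvd m (k%:~R * z) = edvd m z.
Proof.
move=> co; rewrite /edvd !eisE !mul0r subr0 addr0 subr0.
by rewrite !Gauss_dvdzr.
Qed.
(** Multiplying by [conj t] replaces t by the rational integer [norm t], to which Gauss's lemma
    applies coordinatewise. *)
Lemma edvd_Gauss m t z : coprimez m (norm t) -> edvd m (t * z) -> edvd m z.
Proof.
move=> co /(edvdMl (conj t)).
by rewrite mulrA [conj t * t]mulrC mul_conj edvd_Gauss_intr.
Qed.
Lemma edvd_mul_coprime (m k : int) z : coprimez m k ->
  edvd m z -> edvd k z -> edvd (m * k) z.
Proof. by move=> co /andP[h1 h2] /andP[h3 h4]; rewrite /edvd !Gauss_dvdz ?h1 ?h2 ?h3. Qed.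

(* Units have coordinates in {-1, 0, 1}. *)
Lemma unit_mod_eq1 (W : nat) z : (2 < W)%N -> norm z = 1 -> edvd W (z - 1) -> z = 1.
Proof.
move=> W2; rewrite /norm /edvd !eisE oppr0 addr0.
case: z => a b /= hN /andP[/dvdzP[k hk] /dvdzP[l hl]].
have h1 := norm4 (Eis a b); have h2 := norm4' (Eis a b).
rewrite /norm /= hN in h1 h2.
have sq_le1 (c : int) : 3 * c ^+ 2 <= 4 -> -1 <= c <= 1.
  move=> h; apply/andP; split; rewrite leNgt; apply/negP => hc.
    have : 0 <= (c + 2) * (c - 2) by apply: mulr_le0; lia.
    by move: h; rewrite expr2; lia.
  have : 0 <= (c + 2) * (c - 2) by apply: mulr_ge0; lia.
  by move: h; rewrite expr2; lia.
have ha : -1 <= a <= 1 by apply: sq_le1; have := sqr_ge0 (2 * b - a); lia.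
have hb : -1 <= b <= 1 by apply: sq_le1; have := sqr_ge0 (2 * a - b); lia.
have small (c m : int) : -2 <= c <= 1 -> c = m * W%:Z -> m = 0.
  move=> hc hm; have [m0|m0|//] := ltgtP m 0.
    have : 0 <= (- 1 - m) * W%:Z by apply: mulr_ge0; lia.
    by rewrite mulrBl mulN1r -hm; lia.
  have : 0 <= (m - 1) * W%:Z by apply: mulr_ge0; lia.
  by rewrite mulrBl mul1r -hm; lia.
have k0 : k = 0 by apply: small hk; lia.
have l0 : l = 0 by apply: small hl; lia.
by rewrite k0 l0 !mul0r in hk hl; apply: eis_eq; rewrite /= ?re1 ?om1; lia.
Qed.

Definition nnorm z : nat := `|norm z|%N.

Lemma nnormE z : (nnorm z)%:Z = norm z.
Proof. by rewrite /nnorm gez0_abs ?norm_ge0. Qed.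
Lemma nnormM z t : nnorm (z * t) = (nnorm z * nnorm t)%N.
Proof. by rewrite /nnorm normM abszM. Qed.
Lemma nnorm_conj z : nnorm (conj z) = nnorm z.
Proof. by rewrite /nnorm norm_conj. Qed.
Lemma dvdn_nnorm (m : nat) z : (m %| nnorm z)%N = (m %| norm z)%Z.
Proof. by rewrite dvdzE. Qed.

(** * Squarefree numbers and coprimality *)

Definition sqfree m := forall p, prime p -> ~~ (p * p %| m)%N.

Lemma sqfree_logn m p : (0 < m)%N -> sqfree m -> prime p ->
  logn p m = (p %| m)%N :> nat.
Proof.
move=> m0 sq pp; have := sq p pp; rewrite mulnn pfactor_dvdn // -ltnNge ltnS.
have -> : (p %| m)%N = (0 < logn p m)%N by rewrite logn_gt0 mem_primes pp m0.
by case: logn => [|[|]].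
Qed.

Lemma sqfree_eq a b : (0 < a)%N -> (0 < b)%N -> sqfree a -> sqfree b ->
  (forall p, prime p -> (p %| a)%N -> (p %| b)%N) ->
  (forall p, prime p -> (p %| b)%N -> (p %| a)%N) -> a = b.
Proof.
move=> a0 b0 sa sb ab ba; apply: eqn_from_log => // p.
have [pp|npp] := boolP (prime p); last first.
  have lg0 m : logn p m = 0%N by rewrite lognE (negbTE npp).
  by rewrite !lg0.
rewrite !sqfree_logn //; congr (nat_of_bool _).
by apply/idP/idP; [exact: ab|exact: ba].
Qed.

Lemma sqfree_gt0 m : sqfree m -> (0 < m)%N.
Proof. by case: m => // h; have := h 2 isT; rewrite dvdn0. Qed.

Lemma coprimeP_prime m n : (0 < m)%N ->
  (forall p, prime p -> (p %| m)%N -> (p %| n)%N -> False) -> coprime m n.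
Proof.
move=> m0 h; rewrite /coprime; apply/negPn/negP => g1.
have g2 : (1 < gcdn m n)%N by rewrite ltn_neqAle eq_sym g1 gcdn_gt0 m0.
apply: (h _ (pdiv_prime g2)).
  exact: dvdn_trans (pdiv_dvd _) (dvdn_gcdl _ _).
exact: dvdn_trans (pdiv_dvd _) (dvdn_gcdr _ _).
Qed.

Lemma prime_coprime_absurd p m n : prime p -> coprime m n ->
  (p %| m)%N -> (p %| n)%N -> False.
Proof.
move=> pp co pm pn; have := prime_gt1 pp.
by have := coprime_dvdl pm (coprime_dvdr pn co); rewrite /coprime gcdnn => /eqP ->.
Qed.

Lemma coprimezE (m n : nat) : coprimez m%:Z n%:Z = coprime m n.
Proof. by []. Qed.

Lemma dvdzD (m x y : int) : (m %| x -> m %| y -> m %| x + y)%Z.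
Proof. exact: rpredD. Qed.
Lemma dvdzB (m x y : int) : (m %| x -> m %| y -> m %| x - y)%Z.
Proof. exact: rpredB. Qed.

(** * Euler's parametrization and recovery of the data *)

(* 1 - w, which is w^2 sqrt(-3) *)
Definition kap := Eis 1 (- 1).

(** A sum of two cubes is (re + om) times the norm, and re + om of kap z is 3 om z. As u conj u and
    v conj v are rational, om (u m t) and om (v m t) are - om (u conj v) times N(v) and N(u)
    respectively, so both sides become the same multiple of N(u) N(v). *)
Lemma point_cubic u v t (m : int) : m != 0 ->
  conj u * (norm u)%:~R - conj v * (norm v)%:~R = m%:~R * t ->
  re (kap * (u * t)) ^+ 3 + om (kap * (u * t)) ^+ 3 =
  re (kap * (v * t)) ^+ 3 + om (kap * (v * t)) ^+ 3.
Proof.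
move=> m0 h.
have cubes z : re z ^+ 3 + om z ^+ 3 = (re z + om z) * norm z.
  by rewrite /norm; ring.
have trace z : re (kap * z) + om (kap * z) = 3 * om z.
  by rewrite !eisE /kap /=; ring.
have hu : m * om (u * t) = - om (u * conj v) * norm v.
  have -> : m * om (u * t) = om (u * (m%:~R * t)) by rewrite !eisE; ring.
  by rewrite -h /norm !eisE; ring.
have hv : m * om (v * t) = - om (u * conj v) * norm u.
  have -> : m * om (v * t) = om (v * (m%:~R * t)) by rewrite !eisE; ring.
  by rewrite -h /norm !eisE; ring.
apply: (mulfI m0); rewrite !cubes !trace !normM.
have -> : m * (3 * om (u * t) * (norm kap * (norm u * norm t))) =
   m * om (u * t) * (3 * norm kap * norm u * norm t) by ring.
have -> : m * (3 * om (v * t) * (norm kap * (norm v * norm t))) =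
   m * om (v * t) * (3 * norm kap * norm v * norm t) by ring.
by rewrite hu hv; ring.
Qed.

(** Keeps the points off the line x0 + x1 = x2 + x3 = 0: on it u conj v would be rational or v would
    vanish. *)
Lemma point_om u v t (m : int) : 
  conj u * (norm u)%:~R - conj v * (norm v)%:~R = m%:~R * t ->
  re (kap * (u * t)) + om (kap * (u * t)) = 0 -> om (u * conj v) * norm v = 0.
Proof.
move=> h; have -> : re (kap * (u * t)) + om (kap * (u * t)) = 3 * om (u * t).
  by rewrite !eisE /kap /=; ring.
move=> h0; have h1 : om (u * t) = 0 by lia.
have : om (u * (m%:~R * t)) = m * om (u * t) by rewrite !eisE; ring.
have -> : om (u * (m%:~R * t)) = - (om (u * conj v) * norm v).
  by rewrite -h /norm !eisE; ring.
by rewrite h1 mulr0 => /eqP; rewrite oppr_eq0 => /eqP.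
Qed.

Section Data.
Variables (W P : nat).
Hypotheses (W2 : (2 < W)%N) (W3 : (3 %| W)%N).

(* [d_leP] makes every prime factor of d1 N(dl) visible to [exact_] of any
   other data with the same point. *)
Record valid (d1 : nat) (dl et A C : eis) : Prop := Valid {
  sq_d1 : sqfree d1;
  sq_dl : sqfree (nnorm dl);
  sq_et : sqfree (nnorm et);
  co_d1_dl : coprime d1 (nnorm dl);
  co_d_et : coprime (d1 * nnorm dl) (nnorm et);
  d1_W : coprime d1 W;
  dl_W : edvd W (dl - 1);
  et_W : edvd W (et - 1);
  A_W : edvd W (A - 1);
  C_W : edvd W (C - Eis 0 1);
  co_A : coprime (nnorm A) (d1 * nnorm dl * nnorm et);
  co_C : coprime (nnorm C) (nnorm et * nnorm A);
  A_gt1 : (1 < nnorm A)%N;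
  root : exists r : int, [/\
    edvd (d1 * nnorm dl)%N (conj et * C - r%:~R * (et * A)),
    (d1 %| r - 1)%Z & (nnorm dl %| re dl + om dl * r)%Z];
  exact_ : forall p (r : int), prime p -> (p <= P)%N ->
    ~~ (p %| W * (d1 * nnorm dl) * nnorm et)%N -> (p %| r ^+ 3 - 1)%Z ->
    ~~ edvd p (conj et * C - r%:~R * (et * A));
  d_leP : (d1 * nnorm dl <= P)%N }.

Lemma norm_mod1 z : edvd W (z - 1) -> coprime (nnorm z) W.
Proof.
move=> /edvdP[w hw].
have hz : z = 1 + W%:Z%:~R * w by rewrite -hw; ring.
have [k hk] : exists k : int, norm z = 1 + W%:Z * k.
  exists (2 * re w - om w + W%:Z * norm w).
  by rewrite hz /norm !eisE; ring.
rewrite -coprimezE nnormE hk /coprimez; apply/eqP.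
have -> : 1 + W%:Z * k = k * W%:Z + 1 by ring.
by rewrite gcdzC gcdzMDl gcdz1.
Qed.

(** Sending w to r kills dl modulo e = N(dl). As om dl is invertible modulo e, r is a root of X^2 +
    X + 1. *)
Lemma dl_root dl (r : int) : sqfree (nnorm dl) ->
  (nnorm dl %| re dl + om dl * r)%Z -> coprime (nnorm dl) `|om dl| ->
  (nnorm dl %| r ^+ 2 + r + 1)%Z.
Proof.
move=> sq hr co.
have co2 : coprimez (nnorm dl) (om dl * om dl).
  by rewrite coprimezMr; rewrite /coprimez /gcdz /= in co *; rewrite (eqP co) eqxx.
rewrite -(Gauss_dvdzr _ co2).
have -> : om dl * om dl * (r ^+ 2 + r + 1) =
  norm dl + (re dl + om dl * r) * (om dl * r - re dl + om dl).
  by rewrite /norm; ring.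
by rewrite dvdzD ?dvdz_mulr // -nnormE.
Qed.

(** A prime dividing N(dl) and om dl also divides re dl, so its square divides N(dl). *)
Lemma dl_coprime dl : sqfree (nnorm dl) -> coprime (nnorm dl) `|om dl|.
Proof.
move=> sq; apply: coprimeP_prime; first exact: sqfree_gt0.
move=> p pp pe pb; have pb' : (p %| om dl)%Z by rewrite dvdzE.
have pa : (p %| re dl)%Z.
  have : (p %| re dl ^+ 2)%Z.
    have -> : re dl ^+ 2 = norm dl + om dl * (re dl - om dl).
      by rewrite /norm; ring.
    by rewrite dvdzD ?dvdz_mulr // -nnormE dvdzE.
  by rewrite !dvdzE abszX /= Euclid_dvdX // andbT.
have := sq p pp; rewrite dvdn_nnorm.
move/dvdzP: pb' => [b hb]; move/dvdzP: pa => [a ha].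
rewrite /norm ha hb; apply/negP/negPn.
have -> : (a * p%:Z) ^+ 2 - a * p%:Z * (b * p%:Z) + (b * p%:Z) ^+ 2 =
   (p * p)%N%:Z * (a ^+ 2 - a * b + b ^+ 2) by rewrite PoszM; ring.
exact: dvdz_mulr.
Qed.

(** X^2 + X + 1 takes the value 3 at 1, and p is not 3. This tells the primes of d1 from those of
    N(dl). *)
Lemma three_absurd p (r : int) : prime p -> coprime p W ->
  (p %| r - 1)%Z -> (p %| r ^+ 2 + r + 1)%Z -> False.
Proof.
move=> pp pW h1 h2; have : (p %| 3)%Z.
  have -> : 3 = r ^+ 2 + r + 1 - (r - 1) * (r + 2) :> int by ring.
  by rewrite dvdzB ?dvdz_mulr.
by rewrite dvdzE => h3; apply: (prime_coprime_absurd pp pW) => //; exact: dvdn_trans W3.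
Qed.

Section Injectivity.
Variables (d1 d1' : nat) (dl dl' et et' A A' C C' : eis).
Hypotheses (V : valid d1 dl et A C) (V' : valid d1' dl' et' A' C').

(** A prime of d1 N(dl) carries a cube root of unity r with v = r u, and is at most P by [d_leP]. If
    it did not divide d1' N(dl'), it would violate [exact_] for the second data. *)
Lemma valid_prime_class p : prime p -> (p %| d1 * nnorm dl)%N ->
  et = et' -> A = A' -> C = C' -> (p %| d1' * nnorm dl')%N.
Proof.
move=> pp pd eet eA eC; apply/negPn/negP => npd'.
have [r [hr hr1 hr2]] := root V.
have pW : coprime p W.
  apply: coprime_dvdl pd _; rewrite coprimeMl (d1_W V).
  exact: norm_mod1 (dl_W V).
have pn : ~~ (p %| nnorm et)%N.
  by apply/negP => h; apply: (prime_coprime_absurd pp (co_d_et V) pd).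
have hpr : edvd p (conj et * C - r%:~R * (et * A)).
  by apply: edvd_trans hr; rewrite dvdzE.
have r3 : (p %| r ^+ 3 - 1)%Z.
  have -> : r ^+ 3 - 1 = (r - 1) * (r ^+ 2 + r + 1) by ring.
  move: pd; rewrite Euclid_dvdM // => /orP[h|h].
    by apply: dvdz_mulr; apply: dvdz_trans hr1; rewrite dvdzE.
  apply: dvdz_mull; apply: dvdz_trans (dl_root (sq_dl V) hr2 (dl_coprime (sq_dl V))).
  by rewrite dvdzE.
have dgt0 : (0 < d1 * nnorm dl)%N.
  by rewrite muln_gt0 !sqfree_gt0 //; [exact: sq_dl V|exact: sq_d1 V].
have pP : (p <= P)%N by exact: leq_trans (dvdn_leq dgt0 pd) (d_leP V).
have := exact_ V' pp pP _ r3; rewrite -eet -eA -eC hpr => h; apply: notF; apply: h.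
rewrite !Euclid_dvdM // !negb_or pn andbT -negb_or -Euclid_dvdM // npd' andbT.
by rewrite -prime_coprime.
Qed.

Lemma valid_coprime_uA p : prime p -> (p %| d1 * nnorm dl)%N ->
  coprime p (nnorm (et * A)).
Proof.
move=> pp pd; rewrite nnormM coprimeMr (coprime_dvdl pd (co_d_et V)) /=.
rewrite coprime_sym; apply: coprime_dvdr (co_A V); exact: dvdn_mulr.
Qed.

Lemma valid_root_unique (k : nat) (r r' : int) z t : coprime k (nnorm z) ->
  edvd k (t - r%:~R * z) -> edvd k (t - r'%:~R * z) -> (k %| r - r')%Z.
Proof.
move=> co h h'; rewrite -edvd_intr; apply: (@edvd_Gauss _ z).
  by rewrite -nnormE coprimezE.
have -> : z * (r - r')%:~R = (t - r'%:~R * z) - (t - r%:~R * z) by ring.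
exact: edvdB.
Qed.

(** The residue of r modulo p is determined by u and v, and it tells whether p divides d1 (r = 1) or
    N(dl) (r^2 + r + 1 = 0). *)
Lemma valid_prime_split p : prime p ->
  et = et' -> A = A' -> C = C' ->
  ((p %| d1)%N -> (p %| d1')%N) /\ ((p %| nnorm dl)%N -> (p %| nnorm dl')%N).
Proof.
move=> pp eet eA eC.
have [r [hr hr1 hr2]] := root V; have [r' [hr' hr1' hr2']] := root V'.
have pW : (p %| d1 * nnorm dl)%N -> coprime p W.
  move=> pd; apply: coprime_dvdl pd _; rewrite coprimeMl (d1_W V).
  exact: norm_mod1 (dl_W V).
have q := dl_root (sq_dl V) hr2 (dl_coprime (sq_dl V)).
have q' := dl_root (sq_dl V') hr2' (dl_coprime (sq_dl V')).
have same : (p %| d1 * nnorm dl)%N -> (p %| d1' * nnorm dl')%N ->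
    (p %| r - r')%Z.
  move=> pd pd'; apply: (valid_root_unique (valid_coprime_uA pp pd)) (edvd_trans _ hr) _.
    by rewrite dvdzE.
  by rewrite eet eC eA; apply: edvd_trans hr'; rewrite dvdzE.
split=> pd.
  have pD : (p %| d1 * nnorm dl)%N by exact: dvdn_mulr.
  have pD' := valid_prime_class pp pD eet eA eC.
  move: (pD'); rewrite Euclid_dvdM // => /orP[//|pe'].
  case: (@three_absurd p r' pp (pW pD)).
    have -> : r' - 1 = (r - 1) - (r - r') by ring.
    by rewrite dvdzB ?same //; apply: dvdz_trans hr1; rewrite dvdzE.
  by apply: dvdz_trans q'; rewrite dvdzE.
have pD : (p %| d1 * nnorm dl)%N by exact: dvdn_mull.
have pD' := valid_prime_class pp pD eet eA eC.
move: (pD'); rewrite Euclid_dvdM // => /orP[pd1'|//].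
case: (@three_absurd p r pp (pW pD)); last first.
  by apply: dvdz_trans q; rewrite dvdzE.
have -> : r - 1 = (r - r') + (r' - 1) by ring.
by rewrite dvdzD ?same //; apply: dvdz_trans hr1'; rewrite dvdzE.
Qed.

(** Both dl and dl' vanish modulo e when w is sent to r, hence e divides dl' conj dl and dl' is a
    unit times dl. Congruence to 1 modulo W removes the unit. *)
Lemma valid_dl_eq : nnorm dl = nnorm dl' -> et = et' -> A = A' -> C = C' ->
  dl = dl'.
Proof.
move=> ee eet eA eC.
have [r [hr hr1 hr2]] := root V; have [r' [hr' hr1' hr2']] := root V'.
have q := dl_root (sq_dl V) hr2 (dl_coprime (sq_dl V)).
have co : coprime (nnorm dl) (nnorm (et * A)).
  apply: coprimeP_prime => [|p pp pe]; first exact: sqfree_gt0 (sq_dl V).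
  have := valid_coprime_uA pp (dvdn_mull _ pe); rewrite prime_coprime //.
  by move/negP.
have rr : (nnorm dl %| r - r')%Z.
  apply: (valid_root_unique co) (edvd_trans _ hr) _; first by rewrite dvdzE dvdn_mull.
  by rewrite eet eC eA; apply: edvd_trans hr'; rewrite dvdzE ee dvdn_mull.
have hr3 : (nnorm dl %| re dl' + om dl' * r)%Z.
  have -> : re dl' + om dl' * r = re dl' + om dl' * r' + om dl' * (r - r') by ring.
  by rewrite dvdzD ?dvdz_mull // ee.
have /edvdP[w hw] : edvd (nnorm dl) (dl' * conj dl).
  rewrite /edvd !eisE; apply/andP; split.
    have -> : re dl' * (re dl - om dl) - om dl' * - om dl =
       (re dl' + om dl' * r) * (re dl - om dl) -
       (re dl + om dl * r) * (om dl' * r) +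
       om dl' * om dl * (r ^+ 2 + r + 1) by ring.
    by apply: dvdzD; [apply: dvdzB; exact: dvdz_mulr|exact: dvdz_mull].
  have -> : re dl' * - om dl + om dl' * (re dl - om dl) - om dl' * - om dl =
    om dl' * (re dl + om dl * r) - om dl * (re dl' + om dl' * r) by ring.
  by apply: dvdzB; exact: dvdz_mull.
have e0 : (nnorm dl)%:Z != 0 by have := sqfree_gt0 (sq_dl V); lia.
have e0' : (nnorm dl)%:Z%:~R != 0 :> eis by rewrite eis_intr_eq0.
have hw2 : dl' = w * dl.
  apply: (eis_mulfI e0').
  have -> : (nnorm dl)%:Z%:~R * (w * dl) = dl' * conj dl * dl by rewrite hw; ring.
  by rewrite nnormE -mul_conj; ring.
have nw : norm w = 1.
  apply: (mulIf e0); rewrite mul1r {1}nnormE -normM -hw2.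
  by rewrite -nnormE -ee.
suff w1 : w = 1 by rewrite hw2 w1 mul1r.
apply: (unit_mod_eq1 W2 nw); apply: (@edvd_Gauss _ dl).
  by rewrite -nnormE coprimezE coprime_sym; exact: norm_mod1 (dl_W V).
have -> : dl * (w - 1) = (dl' - 1) - (dl - 1) by rewrite hw2; ring.
by apply: edvdB; [exact: dl_W V'|exact: dl_W V].
Qed.

End Injectivity.

(** The divisibility makes z' / z integral, equality of norms makes it a unit, and the congruence
    modulo W makes it 1. *)
Lemma associate_eq z z' : norm z = norm z' -> norm z != 0 ->
  coprime (nnorm z) W -> edvd W (z' - z) -> edvd (norm z) (z' * conj z) -> z' = z.
Proof.
move=> nn n0 co hW /edvdP[w hw].
have n0' : (norm z)%:~R != 0 :> eis by rewrite eis_intr_eq0.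
have hz : z' = w * z.
  apply: (eis_mulfI n0').
  have -> : (norm z)%:~R * (w * z) = z' * conj z * z by rewrite hw; ring.
  by rewrite -mul_conj; ring.
have nw : norm w = 1 by apply: (mulIf n0); rewrite mul1r -normM -hz.
suff w1 : w = 1 by rewrite hz w1 mul1r.
apply: (unit_mod_eq1 W2 nw); apply: (@edvd_Gauss _ z).
  by rewrite -nnormE coprimezE coprime_sym.
by have -> : z * (w - 1) = z' - z by rewrite hz; ring.
Qed.

(** The equation says that z' conj z is a rational integer x, and x^2 = n n'. For squarefree n and
    n' this forces n = n', so z' is z or -z, and W > 2 excludes the sign. *)
Lemma valid_eta_eq n n' z z' : sqfree n -> sqfree n' -> norm z = n%:Z ->
  norm z' = n'%:Z -> edvd W (z - 1) -> edvd W (z' - 1) ->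
  z * conj z' = z' * conj z -> z = z'.
Proof.
move=> sn sn' nz nz' zW zW' h.
have omX : om (z' * conj z) = 0.
  have := congr1 om h.
  have -> : om (z * conj z') = - om (z' * conj z) by rewrite !eisE; ring.
  lia.
pose x := re (z' * conj z).
have hX : z' * conj z = x%:~R.
  by apply: eis_eq; rewrite -/x ?omX ?re_intr ?om_intr.
have nx : x ^+ 2 = (n * n')%N%:Z.
  by rewrite -norm_intr -hX normM norm_conj nz nz' mulrC PoszM.
have incl m m' p : sqfree m -> prime p -> x ^+ 2 = (m * m')%N%:Z ->
    (p %| m)%N -> (p %| m')%N.
  move=> sm pp hx /dvdnP[k hk].
  have px : (p %| x)%Z.
    have : (p %| x ^+ 2)%Z by rewrite hx hk dvdzE /= -mulnA dvdn_mull // dvdn_mulr.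
    by rewrite !dvdzE abszX /= Euclid_dvdX // andbT.
  have [y hy] := dvdzP px.
  have eqn : (p * `|y| ^ 2 = k * m')%N.
    have p0 := prime_gt0 pp.
    apply/eqP; rewrite -(eqn_pmul2l p0); apply/eqP.
    have : `|x ^+ 2|%N = (m * m')%N by rewrite hx.
    rewrite hy abszX abszM /= hk; lia.
  have : (p %| k * m')%N by rewrite -eqn dvdn_mulr.
  rewrite Euclid_dvdM // => /orP[pk|//].
  by have := sm p pp; rewrite hk dvdn_mul.
have nn : n = n'.
  apply: (sqfree_eq (sqfree_gt0 sn) (sqfree_gt0 sn') sn sn') => p pp.
    exact: (incl n n' p sn pp nx).
  by apply: (incl n' n p sn' pp); rewrite mulnC.
have n0 : n%:Z != 0 by have := sqfree_gt0 sn; lia.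
have n0' : n%:Z%:~R != 0 :> eis by rewrite eis_intr_eq0.
have hz : n%:Z%:~R * z' = x%:~R * z.
  by rewrite -hX -nz -mul_conj; ring.
have : (x - n%:Z) * (x + n%:Z) = 0.
  by rewrite -subr_sqr nx -nn PoszM expr2 subrr.
move/eqP; rewrite mulf_eq0 => /orP[/eqP hx|/eqP hx].
  have xn : x = n%:Z by lia.
  by rewrite xn in hz; have := eis_mulfI n0' hz.
have xn : x = - n%:Z by lia.
have z'N : z' = - z.
  by apply: (eis_mulfI n0'); rewrite hz xn; ring.
have h2 : edvd W (2 : int)%:~R.
  have -> : (2 : int)%:~R = -1 * (z - 1) - (z' - 1) by rewrite z'N; ring.
  by apply: edvdB => //; exact: edvdMl.
rewrite edvd_intr in h2; move: h2; rewrite dvdzE /= => /dvdn_leq; lia.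
Qed.

(** The hypothesis is [u : v] = [u' : v']. Coprimality gives N(A) = N(A') and N(C) = N(C'); then A,
    C and eta are recovered in this order, and finally d1 and dl through their primes. *)
Lemma valid_inj d1 d1' dl dl' et et' A A' C C' :
  valid d1 dl et A C -> valid d1' dl' et' A' C' ->
  et * A * (conj et' * C') = et' * A' * (conj et * C) ->
  [/\ d1 = d1', dl = dl', et = et', A = A' & C = C'].
Proof.
move=> V V' h.
have n0 := sqfree_gt0 (sq_et V); have n0' := sqfree_gt0 (sq_et V').
have a0 := A_gt1 V; have a0' := A_gt1 V'.
have /andP[cCn cCA] : coprime (nnorm C) (nnorm et) && coprime (nnorm C) (nnorm A).
  by rewrite -coprimeMr; exact: co_C V.
have /andP[cCn' cCA'] :
    coprime (nnorm C') (nnorm et') && coprime (nnorm C') (nnorm A').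
  by rewrite -coprimeMr; exact: co_C V'.
have cAn : coprime (nnorm A) (nnorm et).
  by apply: coprime_dvdr (co_A V); exact: dvdn_mull.
have cAn' : coprime (nnorm A') (nnorm et').
  by apply: coprime_dvdr (co_A V'); exact: dvdn_mull.
have hn : (nnorm A * nnorm C' = nnorm A' * nnorm C)%N.
  have nn0 : (0 < nnorm et * nnorm et')%N by rewrite muln_gt0 n0.
  apply/eqP; rewrite -(eqn_pmul2l nn0); apply/eqP.
  have := congr1 nnorm h; rewrite !nnormM !nnorm_conj; lia.
have hA : nnorm A = nnorm A'.
  apply/eqP; rewrite eqn_dvd; apply/andP; split.
    by rewrite -(@Gauss_dvdl _ _ (nnorm C)) -?hn ?dvdn_mulr // coprime_sym.
  by rewrite -(@Gauss_dvdl _ _ (nnorm C')) ?hn ?dvdn_mulr // coprime_sym.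
have hC : nnorm C = nnorm C'.
  by apply/eqP; rewrite -(eqn_pmul2l (ltnW a0)) hn {1}hA.
have nA0 : norm A != 0 by rewrite -nnormE; lia.
(* Multiplying by w^2, the inverse of w, moves the class of w modulo W to that of 1. *)
have C_coW z : edvd W (z - Eis 0 1) -> coprime (nnorm z) W.
  move=> hz; have -> : nnorm z = nnorm (z * Eis (-1) (-1)).
    by rewrite nnormM -[LHS]muln1; congr (_ * _)%N.
  apply: norm_mod1; have -> : z * Eis (-1) (-1) - 1 = (z - Eis 0 1) * Eis (-1) (-1).
    by rewrite mulrBl.
  exact: edvdMr.
have eA : A' = A.
  apply: associate_eq => //; first by rewrite -!nnormE hA.
  - exact: norm_mod1 (A_W V).
  - have -> : A' - A = (A' - 1) - (A - 1) by ring.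
    by apply: edvdB; [exact: A_W V'|exact: A_W V].
  apply: (@edvd_Gauss _ (et' * conj et * C)).
    rewrite -!nnormE coprimezE !nnormM nnorm_conj !coprimeMr {1}hA cAn' cAn.
    by rewrite coprime_sym.
  have -> : et' * conj et * C * (A' * conj A) = et' * A' * (conj et * C) * conj A.
    by ring.
  rewrite -h; have -> : et * A * (conj et' * C') * conj A =
     et * (conj et' * C') * (A * conj A) by ring.
  by rewrite mul_conj; apply: edvdMl; rewrite edvd_intr.
have nC0 : norm C != 0.
  rewrite -nnormE; apply/eqP => /eqP; rewrite eqz_nat => /eqP c0.
  by move: cCA; rewrite c0 /coprime gcd0n => /eqP; lia.
have eC : C' = C.
  apply: associate_eq => //; first by rewrite -!nnormE hC.
  - exact: C_coW (C_W V).
  - have -> : C' - C = (C' - Eis 0 1) - (C - Eis 0 1) by ring.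
    by apply: edvdB; [exact: C_W V'|exact: C_W V].
  apply: (@edvd_Gauss _ (et * A * conj et')).
    rewrite -!nnormE coprimezE !nnormM nnorm_conj !coprimeMr cCn cCA /=.
    by rewrite hC.
  have -> : et * A * conj et' * (C' * conj C) = et * A * (conj et' * C') * conj C.
    by ring.
  rewrite h; have -> : et' * A' * (conj et * C) * conj C =
     et' * A' * conj et * (C * conj C) by ring.
  by rewrite mul_conj; apply: edvdMl; rewrite edvd_intr.
have eE : et = et'.
  apply: (valid_eta_eq (sq_et V) (sq_et V')); rewrite ?nnormE //.
  - exact: et_W V.
  - exact: et_W V'.
  have AC0 : A * C != 0.
    apply/eqP => /eis_mulf_eq0[] z0; rewrite z0 norm0 in nA0 nC0; by rewrite eqxx in nA0 nC0.
  apply: (eis_mulfI AC0).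
  have -> : A * C * (et * conj et') = et * A * (conj et' * C') by rewrite eC; ring.
  by rewrite h eA; ring.
have sp p (pp : prime p) := valid_prime_split V V' pp eE (esym eA) (esym eC).
have sp' p (pp : prime p) := valid_prime_split V' V pp (esym eE) eA eC.
have e1 : d1 = d1'.
  apply: (sqfree_eq (sqfree_gt0 (sq_d1 V)) (sqfree_gt0 (sq_d1 V')) (sq_d1 V) (sq_d1 V')).
    by move=> p pp; exact: (sp p pp).1.
  by move=> p pp; exact: (sp' p pp).1.
have e2 : nnorm dl = nnorm dl'.
  apply: (sqfree_eq (sqfree_gt0 (sq_dl V)) (sqfree_gt0 (sq_dl V')) (sq_dl V) (sq_dl V')).
    by move=> p pp; exact: (sp p pp).2.
  by move=> p pp; exact: (sp' p pp).2.
by have e3 := valid_dl_eq V V' e2 eE (esym eA) (esym eC).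
Qed.

End Data.

(** * Counting lattice points under coprimality conditions *)

Lemma card_pair_sum (S T : finType) (P : pred (S * T)) :
  #|P| = (\sum_(y : T) #|[pred x : S | P (x, y)]|)%N.
Proof.
rewrite -sum1_card (eq_bigr (fun y => \sum_(x | P (x, y)) 1)%N); last first.
  by move=> y _; rewrite sum1_card.
rewrite (exchange_big_dep xpredT) //= pair_big_dep /=.
by apply: eq_bigl => -[x y].
Qed.

Lemma card_cell (L s : nat) (P : pred 'I_L) :
  (forall x y : 'I_L, P x -> P y -> (x %/ s = y %/ s)%N -> x = y) ->
  (#|P| <= L %/ s + 1)%N.
Proof.
move=> inj; rewrite addn1.
pose f (x : 'I_L) : 'I_(L %/ s).+1 := inord (x %/ s).
have fE x : f x = (x %/ s)%N :> nat.
  by rewrite /f inordK // ltnS leq_div2r // ltnW.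
rewrite -(@card_in_image _ _ f P); last first.
  by move=> x y Px Py /(congr1 val) /=; rewrite !fE; exact: inj.
by rewrite -[X in (_ <= X)%N]card_ord max_card.
Qed.

Lemma card_cell2 (L s : nat) (P : pred ('I_L * 'I_L)) :
  (forall x y, P x -> P y -> (x.1 %/ s = y.1 %/ s)%N ->
    (x.2 %/ s = y.2 %/ s)%N -> x = y) ->
  (#|P| <= (L %/ s + 1) ^ 2)%N.
Proof.
move=> inj; rewrite addn1.
pose f (x : 'I_L) : 'I_(L %/ s).+1 := inord (x %/ s).
have fE x : f x = (x %/ s)%N :> nat.
  by rewrite /f inordK // ltnS leq_div2r // ltnW.
pose g (t : 'I_L * 'I_L) := (f t.1, f t.2).
rewrite -(@card_in_image _ _ g P); last first.
  move=> x y Px Py [/(congr1 val) /= + /(congr1 val) /=].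
  by rewrite !fE; exact: inj.
by rewrite -mulnn -[X in (_ <= X * X)%N]card_ord -card_prod max_card.
Qed.

Lemma divn_eq_absz (x y s : nat) : (0 < s)%N -> (x %/ s = y %/ s)%N ->
  (`|x%:Z - y%:Z| < s%:Z).
Proof.
move=> s0 h; have := divn_eq x s; have := divn_eq y s.
have := ltn_pmod x s0; have := ltn_pmod y s0; rewrite h.
by move: (y %/ s * s)%N (x %% s)%N (y %% s)%N => a b c; lia.
Qed.

Lemma dvdz_small (m x : int) : (m %| x)%Z -> `|x| < m -> x = 0.
Proof.
move=> /dvdzP[k ->]; rewrite normrM => h.
have m0 : 0 < m by apply: le_lt_trans h; rewrite mulr_ge0.
have [->|k0] := eqVneq k 0; first by rewrite mul0r.
have k1 : 1 <= `|k| by rewrite -gtz0_ge1 normr_gt0.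
by move: h; rewrite (gtr0_norm m0) ltNge ler_peMl // ltW.
Qed.

Section Points.
Variables (W L : nat).
Definition pt z0 (t : 'I_L * 'I_L) :=
  Eis (re z0 + W%:Z * t.1%:Z) (om z0 + W%:Z * t.2%:Z).

Definition lin_dvd (q : nat) (a : int) : pred 'I_L :=
  fun x => (q %| a + W%:Z * x%:Z)%Z.
(** Proportionality of coordinates modulo q. For elements of norm divisible by q with om invertible,
    it says that re / om is the same root of X^2 - X + 1 modulo q. *)
Definition same_root (q : nat) z0 z1 : pred ('I_L * 'I_L) :=
  fun t => (q %| re (pt z0 t) * om z1 - re z1 * om (pt z0 t))%Z.

Lemma lin_dvd_inj (q : nat) (a : int) (x y : 'I_L) : (0 < q)%N ->
  coprime q W -> lin_dvd q a x -> lin_dvd q a y -> (x %/ q = y %/ q)%N -> x = y.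
Proof.
move=> q0 co hx hy hxy; apply: val_inj => /=.
have : (q %| W%:Z * (x%:Z - y%:Z))%Z.
  have -> : W%:Z * (x%:Z - y%:Z) = (a + W%:Z * x%:Z) - (a + W%:Z * y%:Z) by ring.
  exact: dvdzB.
rewrite Gauss_dvdzr // => /dvdz_small; move/(_ (divn_eq_absz q0 hxy)).
by move=> h; apply/eqP; rewrite -eqz_nat -subr_eq0 h.
Qed.

Lemma card_lin (q : nat) (a : int) : (0 < q)%N -> coprime q W ->
  (#|lin_dvd q a| <= L %/ q + 1)%N.
Proof. by move=> q0 co; apply: card_cell => x y; exact: lin_dvd_inj. Qed.

Lemma card_norm (p : nat) z0 : prime p -> coprime p W ->
  (#|[pred t | p %| nnorm (pt z0 t)]| <= L * (2 * (L %/ p + 1)))%N.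
Proof.
move=> pp co; rewrite card_pair_sum.
apply: (@leq_trans (\sum_(y : 'I_L) 2 * (L %/ p + 1))); last first.
  by rewrite sum_nat_const card_ord.
apply: leq_sum => y _; set Q := (X in #|X|).
have [x0 /= hx0|Q0] := pickP Q; last by rewrite eq_card0.
(* On a row om is fixed and the norm is quadratic in re. One zero modulo p factors it, with the two
   roots given by x0 and by the trace. *)
pose a0 := re z0 + W%:Z * x0%:Z; pose b := om z0 + W%:Z * y%:Z.
pose a1 : int := re z0 - a0; pose a2 : int := re z0 + a0 - b.
apply: (@leq_trans #|[predU lin_dvd p a1 & lin_dvd p a2]|).
  apply: subset_leq_card; apply/fintype.subsetP => x.
  rewrite !inE /= /in_mem /= /lin_dvd /a1 /a2 => hx.
  have : (p %| (re z0 - a0 + W%:Z * x%:Z) * (re z0 + a0 - b + W%:Z * x%:Z))%Z.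
    have -> : (re z0 - a0 + W%:Z * x%:Z) * (re z0 + a0 - b + W%:Z * x%:Z) =
      norm (pt z0 (x, y)) - norm (pt z0 (x0, y)).
      by rewrite /norm /a0 /b /=; ring.
    by apply: dvdzB; rewrite -dvdn_nnorm.
  by rewrite !dvdzE abszM Euclid_dvdM.
have p0 := prime_gt0 pp.
rewrite (@leq_trans (#|lin_dvd p a1| + #|lin_dvd p a2|)) //.
  by rewrite -cardUI leq_addr.
by rewrite mul2n -addnn leq_add // card_lin.
Qed.

Lemma card_both (p : nat) z0 : prime p -> coprime p W ->
  (#|[pred t | edvd p (pt z0 t)]| <= (L %/ p + 1) ^ 2)%N.
Proof.
move=> pp co; have p0 := prime_gt0 pp; apply: card_cell2.
move=> [x1 x2] [y1 y2] /= /andP[/= h1 h2] /andP[/= h3 h4] e1 e2.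
by rewrite (lin_dvd_inj p0 co h1 h3 e1) (lin_dvd_inj p0 co h2 h4 e2).
Qed.

(* Two points of the root class of z1 differ by an element of norm divisible
   by p ^ 2, so a square of side p / 2 contains at most one of them. *)
Lemma card_packed (p : nat) z0 z1 : prime p -> coprime p W ->
  (p * p %| nnorm z1)%N -> coprime p `|om z1| ->
  (#|same_root (p * p) z0 z1| <= (L %/ uphalf p + 1) ^ 2)%N.
Proof.
move=> pp co hz1 co1; have p0 := prime_gt0 pp.
have s0 : (0 < uphalf p)%N by rewrite uphalf_gt0.
apply: card_cell2 => -[x1 x2] [y1 y2]; rewrite /same_root /= => h h' e1 e2.
set q := (p * p)%N in h h' *.
have coq k : coprime p k -> coprime q k by move=> ck; rewrite coprimeMl ck.
pose dx := x1%:Z - y1%:Z; pose dy := x2%:Z - y2%:Z.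
have hW : (q %| dx * om z1 - re z1 * dy)%Z.
  have cqW : coprimez q W by exact: coq.
  rewrite -(Gauss_dvdzr _ cqW).
  have -> : W%:Z * (dx * om z1 - re z1 * dy) =
    ((re z0 + W%:Z * x1%:Z) * om z1 - re z1 * (om z0 + W%:Z * x2%:Z)) -
    ((re z0 + W%:Z * y1%:Z) * om z1 - re z1 * (om z0 + W%:Z * y2%:Z)).
    by rewrite /dx /dy; ring.
  exact: dvdzB.
have hN : (q %| norm (Eis dx dy))%Z.
  have cqo : coprimez q (om z1 * om z1).
    by rewrite coprimezMr; apply/andP; split; exact: coq.
  rewrite -(Gauss_dvdzr _ cqo).
  have -> : om z1 * om z1 * norm (Eis dx dy) = dy ^+ 2 * norm z1 +
    (dx * om z1 - re z1 * dy) * (dx * om z1 + re z1 * dy - om z1 * dy).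
    by rewrite /norm /=; ring.
  by apply: dvdzD; [apply: dvdz_mull; rewrite -dvdn_nnorm|exact: dvdz_mulr].
have bx : `|dx| < (uphalf p)%:Z by exact: divn_eq_absz.
have by_ : `|dy| < (uphalf p)%:Z by exact: divn_eq_absz.
have sp : 2 * ((uphalf p)%:Z - 1) < p%:Z.
  by clear; have := odd_double_half p; rewrite uphalf_half; lia.
(* Both differences are at most (p - 1) / 2 in absolute value, so the norm is at most 3 (p - 1)^2 /
   4 < p^2. *)
have N0 : norm (Eis dx dy) = 0.
  apply: dvdz_small hN _; rewrite ger0_norm ?norm_ge0 // /q PoszM.
  have sq (a : int) : `|a| < (uphalf p)%:Z -> 4 * (a * a) <= (p%:Z - 1) * (p%:Z - 1).
    move: sp; clear => sp ha; have h2 : 2 * `|a| <= p%:Z - 1 by lia.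
    have : (2 * `|a|) * (2 * `|a|) <= (p%:Z - 1) * (p%:Z - 1).
      by apply: ler_pM => //; lia.
    have -> : (2 * `|a|) * (2 * `|a|) = 4 * (`|a| * `|a|) by ring.
    by rewrite -normrM ger0_norm // -expr2 sqr_ge0.
  have := sq _ bx; have := sq _ by_; have := sqr_ge0 (dx + dy).
  have : (p%:Z - 1) * (p%:Z - 1) < p%:Z * p%:Z.
    have -> : (p%:Z - 1) * (p%:Z - 1) = p%:Z * p%:Z - 2 * p%:Z + 1 by ring.
    by move: p0; clear; lia.
  rewrite /norm /= !expr2.
  have -> : (dx + dy) * (dx + dy) = dx * dx + 2 * (dx * dy) + dy * dy by ring.
  by clear; lia.
have := norm_eq0 N0 => -[/eqP hx /eqP hy].
move: hx hy; rewrite !subr_eq0 !eqz_nat => /eqP hx /eqP hy.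
by congr (_, _); exact: val_inj.
Qed.

(* A point of norm divisible by p ^ 2 is divisible by p or belongs to the root
   class of one given such point z1 or to that of its conjugate. *)
Lemma card_norm_sq (p : nat) z0 : prime p -> coprime p W -> p != 3%N ->
  (#|[pred t | p * p %| nnorm (pt z0 t)]| <=
    (L %/ p + 1) ^ 2 + 2 * (L %/ uphalf p + 1) ^ 2)%N.
Proof.
move=> pp co p3; set Q := (X in #|X|).
pose Q' := [pred t | Q t && ~~ edvd p (pt z0 t)].
have prim t : Q' t -> coprime p `|om (pt z0 t)|.
  move=> /= /andP[hQ hnd]; rewrite prime_coprime //; apply/negP => pb.
  have pb' : (p %| om (pt z0 t))%Z by rewrite dvdzE.
  case/negP: hnd; rewrite /edvd pb' andbT.
  have : (p %| re (pt z0 t) ^+ 2)%Z.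
    have -> : re (pt z0 t) ^+ 2 = norm (pt z0 t) +
      om (pt z0 t) * (re (pt z0 t) - om (pt z0 t)) by rewrite /norm; ring.
    apply: dvdzD; last exact: dvdz_mulr.
    by rewrite -dvdn_nnorm; apply: dvdn_trans hQ; exact: dvdn_mulr.
  by rewrite !dvdzE abszX Euclid_dvdX // andbT.
have le1 : (#|Q| <= #|[pred t | edvd p (pt z0 t)]| + #|Q'|)%N.
  apply: (@leq_trans #|[predU [pred t | edvd p (pt z0 t)] & Q']|).
    apply: subset_leq_card; apply/fintype.subsetP => t; rewrite !inE /= => ->.
    by rewrite orbN.
  by rewrite -cardUI leq_addr.
apply: (leq_trans le1); apply: leq_add; first exact: card_both.
have [t1 ht1|Q0] := pickP Q'; last by rewrite eq_card0.
set z1 := pt z0 t1.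
have ho1 : coprime p `|om z1| by exact: prim.
have hn1 : (p * p %| nnorm z1)%N by case/andP: ht1.
pose S := same_root (p * p) z0.
apply: (@leq_trans #|[predU S z1 & S (conj z1)]|); last first.
  apply: (@leq_trans (#|S z1| + #|S (conj z1)|)).
    by rewrite -cardUI leq_addr.
  rewrite mul2n -addnn leq_add //; apply: card_packed => //.
    by rewrite nnorm_conj.
  by rewrite !eisE abszN.
apply: subset_leq_card; apply/fintype.subsetP => t; rewrite !inE /in_mem /= => ht.
have ho : coprime p `|om (pt z0 t)| by exact: prim.
have hn : (p * p %| nnorm (pt z0 t))%N by case/andP: ht.
set z := pt z0 t in ho hn *; rewrite /S /same_root -/z.
set f1 := re z * om z1 - _; set f2 := re z * om (conj z1) - _.
(* f1 and f2 vanish on the root classes of z1 and of its conjugate. p^2 divides their product, and p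
   cannot divide both because it divides none of om z, om z1 and 3. *)
have hf : ((p * p)%N %| f1 * f2)%Z.
  have -> : f1 * f2 = om z ^+ 2 * norm z1 - om z1 ^+ 2 * norm z.
    by rewrite /f1 /f2 /norm !eisE; ring.
  by apply: dvdzB; apply: dvdz_mull; rewrite -dvdn_nnorm.
have nboth : ~~ ((p %| f1)%Z && (p %| f2)%Z).
  apply/negP => /andP[h1 h2].
  have : (p %| om z * (2 * re z1 - om z1))%Z.
    have -> : om z * (2 * re z1 - om z1) = - f1 - f2.
      by rewrite /f1 /f2 !eisE; ring.
    by apply: dvdzB; rewrite ?dvdzN // dvdzE abszN -dvdzE.
  rewrite Gauss_dvdzr // => h3.
  have : (p %| 3 * (om z1 * om z1))%Z.
    have -> : 3 * (om z1 * om z1) =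
      4 * norm z1 - (2 * re z1 - om z1) * (2 * re z1 - om z1).
      by rewrite /norm; ring.
    apply: dvdzB; last exact: dvdz_mulr.
    apply: dvdz_mull; rewrite -dvdn_nnorm.
    by apply: dvdn_trans hn1; exact: dvdn_mulr.
  rewrite Gauss_dvdzl; last by rewrite coprimezMr; apply/andP.
  by rewrite dvdzE /= dvdn_prime2 // (negbTE p3).
move: nboth; rewrite negb_and => /orP[h|h].
  apply/orP; right; rewrite Gauss_dvdzr // in hf.
  rewrite /coprimez /gcdz; change (coprime (p * p) `|f1|).
  by rewrite coprimeMl !prime_coprime // !andbb; move: h; rewrite dvdzE.
apply/orP; left; rewrite Gauss_dvdzl // in hf.
rewrite /coprimez /gcdz; change (coprime (p * p) `|f2|).
by rewrite coprimeMl !prime_coprime // !andbb; move: h; rewrite dvdzE.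
Qed.

End Points.

(** * Sums over primes and union bounds *)

Section Counting.
Variable R : realFieldType.

Lemma inv_sqr_step (x : R) : 0 < x -> (x + 1)^-1 ^+ 2 <= x^-1 - (x + 1)^-1.
Proof.
move=> x0; have x1 : 0 < x + 1 by rewrite addr_gt0.
have -> : x^-1 - (x + 1)^-1 = x^-1 * (x + 1)^-1.
  by field; rewrite !lt0r_neq0.
by rewrite expr2 ler_pM2r ?invr_gt0 // lef_pV2 ?posrE // lerDl.
Qed.

(** Telescoping comparison of 1 / (x + 1)^2 with 1 / x - 1 / (x + 1). *)
Lemma sum_inv_sqr_le (P0 Q : nat) : (0 < P0)%N ->
  \sum_(0 <= p < Q | (P0 < p)%N) (p%:R^-1 : R) ^+ 2 <= P0%:R^-1.
Proof.
move=> P0_gt0; have P0r : (0 : R) < P0%:R by rewrite ltr0n.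
suff H k : \sum_(0 <= p < (P0 + k).+1 | (P0 < p)%N) (p%:R^-1 : R) ^+ 2 <=
    P0%:R^-1 - (P0 + k)%:R^-1.
  have [QP|QP] := leqP Q P0.
    rewrite big_nat_cond big1 ?invr_ge0 ?ler0n // => p.
    by move=> /andP[/andP[_ h1] h2]; move: (ltn_trans h2 h1); rewrite ltnNge QP.
  have := H (Q - P0.+1)%N.
  have -> : (P0 + (Q - P0.+1)).+1 = Q by lia.
  by move=> /le_trans; apply; rewrite gerBl invr_ge0 ler0n.
elim: k => [|k IHk].
  rewrite addn0 subrr big_nat_cond big1 // => p.
  by move=> /andP[/andP[_ h1] h2]; lia.
rewrite addnS big_mkcond big_nat_recr //= -big_mkcond /= ifT; last by lia.
set x : R := (P0 + k)%:R; have x0 : 0 < x by rewrite /x ltr0n addn_gt0 P0_gt0.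
have -> : (P0 + k).+1%:R = x + 1 by rewrite -natr1.
have step := inv_sqr_step x0.
have := lerD IHk step; rewrite -/x => /le_trans; apply.
by rewrite addrA subrK.
Qed.

Lemma union_bound (T : finType) (s : seq nat) (c : pred nat)
    (B : nat -> pred T) (F : nat -> R) :
  (forall p, p \in s -> c p -> (#|B p|)%:R <= F p) ->
  (#|[pred t | has (fun p => c p && B p t) s]|)%:R <= \sum_(p <- s | c p) F p.
Proof.
elim: s => [|p s IHs] hF; first by rewrite big_nil eq_card0.
rewrite big_cons; have {}IHs := IHs (fun q qs => hF q (mem_behead (s := p :: s) qs)).
case: ifP => cp; last first.
  by apply: le_trans IHs; rewrite ler_nat; apply/eq_leq/eq_card => t; rewrite !inE /= cp.
have := lerD (hF p (mem_head _ _) cp) IHs; apply: le_trans.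
rewrite -natrD ler_nat -cardUI; apply: leq_trans (leq_addr _ _).
by apply: subset_leq_card; apply/fintype.subsetP => t; rewrite !inE /= cp.
Qed.

(** Makes the number of prime factors logarithmic, so that the large ones can be handled by a crude
    union bound. *)
Lemma two_exp_size_primes m : (0 < m)%N -> (2 ^ size (primes m) <= m)%N.
Proof.
move=> m0; rewrite [leqRHS](prod_prime_decomp m0) /primes size_map.
have : all (fun f : nat * nat => (1 < f.1)%N && (0 < f.2)%N) (prime_decomp m).
  apply/allP => -[p e] /= /mem_prime_decomp[pp e0 _].
  by rewrite prime_gt1.
elim: (prime_decomp m) => [|f s IHs] /=; first by rewrite big_nil.
move=> /andP[/andP[f1 f2] /IHs h]; rewrite big_cons expnS leq_mul //.
apply: (leq_trans f1); rewrite -[leqLHS]expn1.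
by apply: leq_pexp2l => //; exact: ltnW.
Qed.

(** Controls the proportion of elements whose norm shares a prime at most D with m. *)
Definition recsum (D m : nat) : R :=
  \sum_(0 <= p < D.+1 | prime p && (p %| m)%N) p%:R^-1.

Lemma recsum_primes D m : (0 < m)%N ->
  recsum D m = \sum_(p <- primes m | (p <= D)%N) p%:R^-1.
Proof.
move=> m0; rewrite /recsum -big_filter -[RHS]big_filter; apply: perm_big.
apply: uniq_perm; rewrite ?filter_uniq ?iota_uniq ?primes_uniq // => p.
rewrite !mem_filter mem_index_iota mem_primes m0 /= ltnS.
by case: (prime p); case: (p %| m)%N; rewrite ?andbF ?andbT.
Qed.

Lemma recsumM D a b : recsum D (a * b)%N <= recsum D a + recsum D b.
Proof.
rewrite /recsum !(big_mkcond (fun p => prime p && _)) -big_split.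
apply: ler_sum => p _ /=.
have [pp|_] /= := boolP (prime p); last by rewrite addr0.
have pi : (0 : R) <= p%:R^-1 by rewrite invr_ge0 ler0n.
rewrite Euclid_dvdM //; case: (p %| a)%N => /=; last by rewrite add0r.
by rewrite lerDl; case: ifP.
Qed.

Lemma divn_le_ratr (L p : nat) : (0 < p)%N -> ((L %/ p)%N%:R : R) <= L%:R / p%:R.
Proof.
by move=> p0; rewrite ler_pdivlMr ?ltr0n // -natrM ler_nat leq_trunc_div.
Qed.

Section Coprime.
Variables (W L D l g : nat) (z0 : eis).
Hypotheses (D0 : (0 < D)%N) (DL : (D <= L)%N) (g0 : (0 < g)%N)
  (coW : coprime g W) (gl : (size (primes g) <= l)%N).

Lemma card_norm_rat p : prime p -> coprime p W ->
  (#|[pred t | p %| nnorm (pt W z0 t)]%N : pred ('I_L * 'I_L)|%:R : R) <=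
  2 * L%:R ^+ 2 / p%:R + 2 * L%:R.
Proof.
move=> pp cp; have p0 := prime_gt0 pp.
apply: le_trans (_ : ((L * (2 * (L %/ p + 1)))%N%:R : R) <= _).
  by rewrite ler_nat card_norm.
rewrite natrM natrM natrD; have := divn_le_ratr L p0.
set x : R := (L %/ p)%N%:R; set y : R := L%:R => h.
have y0 : 0 <= y by rewrite /y ler0n.
have -> : 2 * y ^+ 2 / p%:R + 2 * y = y * (2 * (y / p%:R + 1)) by ring.
by rewrite ler_wpM2l // ler_wpM2l // lerD2r.
Qed.

(** As D <= L, a prime p <= D dividing g costs a proportion of at most 4 / p, and each of the at
    most l primes above D costs at most 4 / D. *)
Lemma not_coprime_count :
  (#|[pred t | ~~ coprime (nnorm (pt W z0 t)) g] : pred ('I_L * 'I_L)|%:R : R) <=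
  4 * L%:R ^+ 2 * (recsum D g + l%:R / D%:R).
Proof.
pose F (p : nat) : R := 4 * L%:R ^+ 2 *
  ((if (p <= D)%N then p%:R^-1 else 0) + D%:R^-1).
have Lr : (0 : R) <= L%:R ^+ 2 by rewrite exprn_ge0 ?ler0n.
have D0r : (0 : R) < D%:R by rewrite ltr0n.
have L1 : (L%:R : R) <= L%:R ^+ 2 / D%:R.
  rewrite ler_pdivlMr // expr2 ler_wpM2l ?ler0n // ler_nat //.
apply: le_trans (_ : \sum_(p <- primes g | xpredT p) F p <= _).
  apply: le_trans (@union_bound _ (primes g) xpredT
    (fun p => [pred t | p %| nnorm (pt W z0 t)]%N) F _); last first.
    move=> p; rewrite mem_primes => /and3P[pp _ pg] _.
    apply: le_trans (card_norm_rat pp (coprime_dvdl pg coW)) _.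
    have pr : (0 : R) < p%:R by rewrite ltr0n prime_gt0.
    rewrite /F; case: leqP => pD; last first.
      rewrite add0r; have : L%:R ^+ 2 / p%:R <= L%:R ^+ 2 / D%:R :> R.
        by rewrite ler_wpM2l // lef_pV2 ?posrE // ler_nat ltnW.
      by move: L1; lra.
    have : L%:R ^+ 2 / D%:R <= L%:R ^+ 2 / p%:R :> R.
      by rewrite ler_wpM2l // lef_pV2 ?posrE // ler_nat.
    have : 0 <= L%:R ^+ 2 / D%:R :> R by rewrite divr_ge0 // ltW.
    by move: L1; lra.
  rewrite ler_nat; apply: subset_leq_card; apply/fintype.subsetP => t; rewrite !inE /= => h.
  apply/negPn/negP => /hasPn h2; case/negP: h; rewrite coprime_sym.
  apply: coprimeP_prime => // p pp pg pn.
  by have := h2 p; rewrite mem_primes pp g0 pg pn => /(_ isT).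
rewrite -mulr_sumr ler_wpM2l ?mulr_ge0 //.
rewrite big_split /= -big_mkcond -recsum_primes // lerD2l.
rewrite big_const_seq iter_addr_0 count_predT.
by rewrite -[X in X <= _]mulr_natl ler_wpM2r ?invr_ge0 ?ler0n // ler_nat.
Qed.

End Coprime.

Lemma leq_double_uphalf p : (p <= 2 * uphalf p)%N.
Proof. by have := odd_double_half p; rewrite uphalf_half mul2n; lia. Qed.

(** Boolean form testing only the primes dividing m. As [primes 0] is empty, it accepts 0. *)
Definition sqfreeb m := all (fun p => ~~ (p * p %| m)%N) (primes m).

Lemma sqfreebP m : (0 < m)%N -> sqfreeb m -> sqfree m.
Proof.
move=> m0 /allP h p pp; apply/negP => hp; have := h p.
by rewrite mem_primes pp m0 (dvdn_trans _ hp) ?dvdn_mulr // hp => /(_ isT).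
Qed.

Lemma half_good (T : finType) (G B1 B2 B3 : pred T) (N : nat) :
  #|T| = N -> (forall t, ~~ G t -> [|| B1 t, B2 t | B3 t]) ->
  ((#|B1|%:R + #|B2|%:R + #|B3|%:R : R) <= N%:R / 2) ->
  (N <= 2 * #|G|)%N.
Proof.
move=> cT cov h.
have h1 : (N <= #|G| + (#|B1| + (#|B2| + #|B3|)))%N.
  rewrite -cT -(cardC G) leq_add2l.
  apply: (@leq_trans #|[predU B1 & [predU B2 & B3]]|).
    by apply: subset_leq_card; apply/fintype.subsetP => t; rewrite !inE; exact: cov.
  apply: (@leq_trans (#|B1| + #|[predU B2 & B3]|)).
    by rewrite -cardUI leq_addr.
  by rewrite leq_add2l -cardUI leq_addr.
have h2 : (N%:R : R) <= #|G|%:R + (#|B1|%:R + (#|B2|%:R + #|B3|%:R)).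
  by rewrite -!natrD ler_nat.
rewrite -(ler_nat R) natrM; move: h h2.
move: (N%:R : R) (#|G|%:R : R) (#|B1|%:R : R) (#|B2|%:R : R) (#|B3|%:R : R).
by move=> *; lra.
Qed.

(** * Blocks of elements congruent to 1 modulo W *)

Section Blocks.
Variables (W L : nat).
Hypothesis W_gt0 : (0 < W)%N.

(** These are the 1 + W (L + x + y w) with 0 <= x, y < L. The shift by L makes the norm comparable
    to (W L)^2. *)
Definition blk (t : 'I_L * 'I_L) : eis := pt W (Eis (1 + W%:Z * L%:Z) 0) t.

Lemma blk_W t : edvd W (blk t - 1).
Proof.
apply/edvdP; exists (Eis (L%:Z + t.1%:Z) t.2%:Z).
by apply: eis_eq; rewrite !eisE /blk /pt /=; ring.
Qed.

Lemma blk_coords t : [/\ W%:Z * L%:Z <= re (blk t), re (blk t) <= 2 * (W%:Z * L%:Z),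
  0 <= om (blk t) & om (blk t) <= W%:Z * L%:Z].
Proof.
case: t => x y; rewrite /blk /pt /=.
have hx : W%:Z * x%:Z <= W%:Z * (L%:Z - 1) by rewrite ler_wpM2l //; have := ltn_ord x; lia.
have hx0 : 0 <= W%:Z * x%:Z by rewrite mulr_ge0.
have hy : W%:Z * y%:Z <= W%:Z * L%:Z by rewrite ler_wpM2l //; have := ltn_ord y; lia.
have hy0 : 0 <= W%:Z * y%:Z by rewrite mulr_ge0.
by split; rewrite ?add0r //; lia.
Qed.

(** Since 0 <= om <= re, the norm lies between 3 re^2 / 4 and re^2. *)
Lemma blk_norm t : (3 * (W * L) ^ 2 <= 4 * nnorm (blk t))%N /\
  (nnorm (blk t) <= (2 * W * L) ^ 2)%N.
Proof.
have [h1 h2 h3 h4] := blk_coords t.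
have h4' : om (blk t) <= re (blk t) by lia.
have WL0 : 0 <= W%:Z * L%:Z by rewrite mulr_ge0.
split.
  rewrite -mulnn -lez_nat !PoszM nnormE norm4'.
  have : (W%:Z * L%:Z) * (W%:Z * L%:Z) <= re (blk t) * re (blk t) by apply: ler_pM.
  by have := sqr_ge0 (2 * om (blk t) - re (blk t)); rewrite expr2; lia.
rewrite -lez_nat nnormE -mulnn !PoszM -mulrA.
have : re (blk t) * re (blk t) <= (2 * (W%:Z * L%:Z)) * (2 * (W%:Z * L%:Z)).
  by apply: ler_pM => //; lia.
have : 0 <= om (blk t) * (re (blk t) - om (blk t)) by rewrite mulr_ge0 //; lia.
by rewrite /norm !expr2; lia.
Qed.

Lemma blk_gt0 t : (0 < nnorm (blk t))%N.
Proof.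
have [h _] := blk_norm t; have L0 : (0 < L)%N by case: t.1 => x; exact: leq_trans.
have : (0 < 3 * (W * L) ^ 2)%N by rewrite muln_gt0 expn_gt0 muln_gt0 W_gt0 L0.
by move=> h2; have := leq_trans h2 h; rewrite muln_gt0.
Qed.

Definition lin_blk (x : 'I_L) : nat := (1 + W * (L + x))%N.

Lemma lin_blk_coprime x : coprime (lin_blk x) W.
Proof.
rewrite /lin_blk -coprimezE /coprimez; apply/eqP.
have -> : (1 + W * (L + x))%N%:Z = (L + x)%N%:Z * W%:Z + 1 by rewrite PoszD PoszM; ring.
by rewrite gcdzC gcdzMDl gcdz1.
Qed.

Lemma lin_blk_bounds x : (W * L <= lin_blk x)%N /\ (lin_blk x <= 2 * W * L)%N.
Proof.
have := ltn_ord x; rewrite /lin_blk => hx; split.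
  by rewrite mulnDr; lia.
have : (W * (L + x).+1 <= W * (2 * L))%N by rewrite leq_mul2l; lia.
by rewrite mulnS mulnCA mulnA; lia.
Qed.

End Blocks.

(** * Density of the good elements of a block *)

Section Block.
(** D separates small primes from large ones and l will bound the number of prime factors. By [P0W]
    every relevant prime exceeds P0, so the sums of 1 / p^2 stay below 1 / 4000. *)
Variables (P0 W D l : nat).
Hypotheses (P0_gt0 : (0 < P0)%N) (P0r : (P0%:R : R)^-1 <= 1 / (40 * 100))
  (W_gt0 : (0 < W)%N) (W3 : (3 %| W)%N)
  (P0W : forall p, prime p -> coprime p W -> (P0 < p)%N)
  (D_gt0 : (0 < D)%N) (WD : (200 * 100 * W%:R : R) <= D%:R)
  (lD : (4 * 100 * l%:R : R) <= D%:R).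

(** Exchanging sums, the total of [recsum] is at most the sum of 4 N / p^2 over p > P0, hence at
    most N / 1000. Markov's inequality at level 1 / 100 then gives N / 10. *)
Lemma recsum_markov (T : finType) (m : T -> nat) (N : nat) :
  (forall t, coprime (m t) W) ->
  (forall p, prime p -> coprime p W -> (p <= D)%N ->
    (#|[pred t | p %| m t]%N|%:R : R) <= 4 * N%:R / p%:R) ->
  (#|[pred t | ~~ (recsum D (m t) <= 1 / 100)]|%:R : R) <= N%:R / 10.
Proof.
move=> coW hp.
set B := [pred t | _].
have tot : \sum_t recsum D (m t) <= N%:R / (10 * 100).
  rewrite /recsum; under eq_bigr do rewrite big_mkcond /=.
  rewrite exchange_big /=.
  apply: le_trans (_ : \sum_(0 <= p < D.+1 | (P0 < p)%N)
      4 * N%:R * (p%:R^-1) ^+ 2 <= _); last first.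
    rewrite -mulr_sumr; have := sum_inv_sqr_le D.+1 P0_gt0.
    have N0 : (0 : R) <= 4 * N%:R by rewrite mulr_ge0 ?ler0n.
    move=> h; have := ler_wpM2l N0 (le_trans h P0r) => /le_trans; apply.
    by move: (N%:R : R) => x; lra.
  rewrite [leRHS]big_mkcond /= big_nat_cond [leRHS]big_nat_cond.
  apply: ler_sum => p /andP[/andP[_ pD] _]; rewrite -big_mkcond /=.
  have nn : (0 : R) <= 4 * N%:R * (p%:R^-1) ^+ 2.
    by apply: mulr_ge0; [exact: mulr_ge0|exact: sqr_ge0].
  have [pp|npp] := boolP (prime p); last first.
    by rewrite big1 ?big_pred0 //; case: ifP.
  have p0 := prime_gt0 pp.
  have [cp|ncp] := boolP (coprime p W); last first.
    rewrite big1; last first.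
      move=> t /= pm; case/negP: ncp; exact: coprime_dvdl pm (coW t).
    by case: ifP.
  rewrite (P0W pp cp) (eq_bigl [pred t | p %| m t]%N) //.
  rewrite sumr_const -[X in X <= _]mulr_natl.
  have := hp p pp cp pD => h.
  have pi : (0 : R) <= p%:R^-1 by rewrite invr_ge0 ler0n.
  by rewrite expr2 (mulrA (4 * N%:R)); exact: ler_wpM2r.
have low : #|B|%:R / 100 <= \sum_t recsum D (m t).
  rewrite (bigID (mem B)) /= -[leLHS]addr0 lerD //; last first.
    by apply: sumr_ge0 => t _; apply: sumr_ge0 => p _; rewrite invr_ge0 ler0n.
  have -> : #|B|%:R / 100 = \sum_(t in B) (1 / 100 : R).
    by rewrite sumr_const -[RHS]mulr_natl mul1r.
  by apply: ler_sum => t; rewrite inE /= -ltNge => /ltW.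
have := le_trans low tot; move: (N%:R : R) (#|B|%:R : R) => x y; lra.
Qed.

Section SquareBlock.
Variable L : nat.
Hypothesis DL : (D <= L)%N.

Definition blk_good (g : nat) (t : 'I_L * 'I_L) :=
  [&& sqfreeb (nnorm (blk W t)), recsum D (nnorm (blk W t)) <= 1 / 100 &
     coprime (nnorm (blk W t)) g].

Lemma L_ge : (L%:R : R) * W%:R <= L%:R ^+ 2 / (200 * 100).
Proof.
have h : (200 * 100 * W%:R : R) <= L%:R by apply: (le_trans WD); rewrite ler_nat.
by have := ler_wpM2l (ler0n R L) h; rewrite expr2; lra.
Qed.

Lemma blk_sq_count :
  (#|[pred t : 'I_L * 'I_L | ~~ sqfreeb (nnorm (blk W t))]|%:R : R) <= L%:R ^+ 2 / 20.
Proof.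
pose c p := prime p && (P0 < p)%N && coprime p W.
(* With y = L / p, [card_norm_sq] gives (y + 1)^2 + 2 (2 y + 1)^2 <= 18 y^2 + 6. *)
pose F (p : nat) : R := 18 * L%:R ^+ 2 * (p%:R^-1) ^+ 2 + 6.
apply: le_trans (_ : \sum_(p <- index_iota 0 (2 * W * L).+1 | c p) F p <= _).
  apply: le_trans (@union_bound _ (index_iota 0 (2 * W * L).+1) c
    (fun p => [pred t : 'I_L * 'I_L | p * p %| nnorm (blk W t)]%N) F _); last first.
    move=> p _ /andP[/andP[pp P0p] cp].
    have p3 : p != 3%N.
      apply/eqP => p3; rewrite p3 in cp; move: cp.
      by rewrite /coprime (gcdn_idPl W3).
    have := @card_norm_sq W L p (Eis (1 + W%:Z * L%:Z) 0) pp cp p3.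
    rewrite -(ler_nat R) => /le_trans; apply.
    have p0 := prime_gt0 pp.
    have s0 : (0 < uphalf p)%N by rewrite uphalf_gt0.
    have d1 := divn_le_ratr L p0; have d2 := divn_le_ratr L s0.
    have pr : (0 : R) < p%:R by rewrite ltr0n.
    have d3 : ((L %/ uphalf p)%N%:R : R) <= 2 * (L%:R / p%:R).
      apply: (le_trans d2); rewrite mulrCA ler_wpM2l ?ler0n //.
      rewrite -[2](invrK 2) -invfM lef_pV2 ?posrE ?mulr_gt0 ?invr_gt0 ?ltr0n //.
      have := leq_double_uphalf p; rewrite -(ler_nat R) natrM; move: (p%:R : R) ((uphalf p)%:R : R) => a b.
      by rewrite mulrC; lra.
    rewrite natrD natrM !natrX !natrD /F.
    have a0 : (0 : R) <= (L %/ p)%N%:R by rewrite ler0n.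
    have b0 : (0 : R) <= (L %/ uphalf p)%N%:R by rewrite ler0n.
    have y0 : (0 : R) <= L%:R / p%:R by rewrite divr_ge0 ?ler0n.
    have -> : 18 * L%:R ^+ 2 * (p%:R^-1) ^+ 2 + 6 = 18 * (L%:R / p%:R) ^+ 2 + 6 :> R.
      by rewrite exprMn [in RHS]mulrA.
    move: d1 d3 a0 b0 y0; move: ((L %/ p)%N%:R : R) ((L %/ uphalf p)%N%:R : R).
    move: (L%:R / p%:R : R) => y a b h1 h2 a0 b0 y0.
    have s1 : (a + 1) ^+ 2 <= (y + 1) ^+ 2 by rewrite ler_sqr ?nnegrE; lra.
    have s2 : (b + 1) ^+ 2 <= (2 * y + 1) ^+ 2 by rewrite ler_sqr ?nnegrE; lra.
    have := sqr_ge0 (y - 1); have := sqr_ge0 (2 * y - 1).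
    by move: s1 s2; rewrite !expr2; lra.
  rewrite ler_nat; apply: subset_leq_card; apply/fintype.subsetP => t; rewrite !inE.
  move=> /allPn[p]; rewrite mem_primes => /and3P[pp _ pm] /negPn ppm.
  (* p^2 divides a positive norm that is at most (2 W L)^2. *)
  have pin : p \in index_iota 0 (2 * W * L).+1.
    rewrite mem_index_iota ltnS /= -leq_sqr -[leqLHS]mulnn.
    by apply: (leq_trans (dvdn_leq (blk_gt0 W_gt0 t) ppm)); exact: (blk_norm W_gt0 t).2.
  have cp : coprime p W by exact: coprime_dvdl pm (norm_mod1 (blk_W W t)).
  have cpp : c p && (p * p %| nnorm (blk W t))%N by rewrite ppm andbT /c pp cp P0W.
  by apply/hasP; exists p; [exact: pin|exact: cpp].
apply: le_trans (_ : \sum_(0 <= p < (2 * W * L).+1 | (P0 < p)%N)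
    18 * L%:R ^+ 2 * (p%:R^-1) ^+ 2 + \sum_(0 <= p < (2 * W * L).+1) 6 <= _).
  rewrite big_split /=; apply: lerD.
    rewrite big_mkcond [leRHS]big_mkcond /=; apply: ler_sum => p _; rewrite /c.
    have h0 : 0 <= 18 * L%:R ^+ 2 * (p%:R^-1 : R) ^+ 2.
      by apply: mulr_ge0; [apply: mulr_ge0 => //; exact: sqr_ge0|exact: sqr_ge0].
    by case: (P0 < p)%N; rewrite ?andbF //=; case: ifP.
  by rewrite big_mkcond; apply: ler_sum => p _; case: ifP.
(* The main terms total at most 18 L^2 / 4000. The constants 6 add up to O(W L), which is absorbed
   because L >= D >= 20000 W. *)
rewrite -mulr_sumr sumr_const_nat subn0.
have Lr : (0 : R) <= 18 * L%:R ^+ 2 by apply: mulr_ge0 => //; exact: sqr_ge0.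
have := ler_wpM2l Lr (le_trans (sum_inv_sqr_le (2 * W * L).+1 P0_gt0) P0r).
have L1 : (1 : R) <= L%:R * W%:R.
  by rewrite -natrM ler1n muln_gt0 W_gt0 (leq_trans D_gt0 DL).
have -> : 6 *+ (2 * W * L).+1 = 12 * (L%:R * W%:R) + 6 :> R.
  by rewrite -[LHS]mulr_natr -[(2 * W * L).+1%:R]natr1 !natrM; ring.
have := L_ge.
have := sqr_ge0 (L%:R : R).
move: Lr L1; move: (\sum_(_ <= p < _ | _) _) => S.
by rewrite !expr2; move: (L%:R : R) (W%:R : R) => x y; lra.
Qed.

Lemma blk_count (g : nat) : (0 < g)%N -> coprime g W -> (size (primes g) <= l)%N ->
  recsum D g <= 3 / 100 -> (L * L <= 2 * #|blk_good g|)%N.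
Proof.
move=> g0 cg gl rg.
apply: (@half_good _ _ [pred t : 'I_L * 'I_L | ~~ sqfreeb (nnorm (blk W t))]
  [pred t : 'I_L * 'I_L | ~~ (recsum D (nnorm (blk W t)) <= 1 / 100)]
  [pred t : 'I_L * 'I_L | ~~ coprime (nnorm (blk W t)) g]).
- by rewrite card_prod !card_ord.
- by move=> t; rewrite /blk_good !negb_and.
(* The bad proportions are at most 1 / 20, 1 / 10 and 4 (3 / 100 + 1 / 400) = 13 / 100, together
   less than one half. *)
have b1 := blk_sq_count.
have b3 := not_coprime_count (Eis (1 + W%:Z * L%:Z) 0) D_gt0 DL g0 cg gl.
have b2 := @recsum_markov _ (fun t : 'I_L * 'I_L => nnorm (blk W t)) (L * L)
  (fun t => norm_mod1 (blk_W W t)).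
have {}b2 := b2 _.
have hb2 : forall p : nat, prime p -> coprime p W -> (p <= D)%N ->
   (#|[pred t : 'I_L * 'I_L | p %| nnorm (blk W t)]%N|%:R : R) <= 4 * (L * L)%N%:R / p%:R.
  move=> p pp cp pD.
  apply: le_trans (card_norm_rat L (Eis (1 + W%:Z * L%:Z) 0) pp cp) _.
  have pr : (0 : R) < p%:R by rewrite ltr0n prime_gt0.
  have : (L%:R : R) <= L%:R ^+ 2 / p%:R.
    rewrite ler_pdivlMr // expr2 ler_wpM2l ?ler0n // ler_nat.
    exact: leq_trans DL.
  by rewrite natrM; lra.
have {hb2}b2 := b2 hb2.
have D0r : (0 : R) < D%:R by rewrite ltr0n.
have lD' : l%:R / D%:R <= 1 / (4 * 100) :> R.
  by rewrite ler_pdivrMr //; move: lD; lra.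
have Lr : (0 : R) <= 4 * L%:R ^+ 2 by apply: mulr_ge0 => //; exact: sqr_ge0.
have b3' := ler_wpM2l Lr (lerD rg lD').
have := le_trans b3 b3'; move: b1 b2; rewrite natrM.
have := sqr_ge0 (L%:R : R); rewrite !expr2 /blk.
move: (#|_|%:R : R) => u; move: (#|_|%:R : R) => v; move: (#|_|%:R : R) => w.
by move: (L%:R : R) => x; lra.
Qed.

End SquareBlock.

(** Modulo p, X^3 - 1 = (X - 1) (X - r0) (X + 1 + r0). *)
Lemma root_cover (p : nat) (r r0 : int) : prime p -> (p %| r ^+ 3 - 1)%Z ->
  (p %| r0 ^+ 2 + r0 + 1)%Z ->
  [|| (p %| r - 1)%Z, (p %| r - r0)%Z | (p %| r - (- 1 - r0))%Z].
Proof.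
move=> pp h h0.
have : (p %| (r - 1) * (r ^+ 2 + r + 1))%Z.
  by have -> : (r - 1) * (r ^+ 2 + r + 1) = r ^+ 3 - 1 by ring.
rewrite dvdzE abszM Euclid_dvdM // -!dvdzE => /orP[->//|h1].
have : (p %| (r - r0) * (r - (- 1 - r0)))%Z.
  have -> : (r - r0) * (r - (- 1 - r0)) = (r ^+ 2 + r + 1) - (r0 ^+ 2 + r0 + 1) by ring.
  exact: dvdzB.
by rewrite dvdzE abszM Euclid_dvdM // -!dvdzE => /orP[->|->]; rewrite ?orbT.
Qed.

(** * Avoiding further cube roots of unity *)

Section ExactCount.
Variables (Wd K : nat) (C0 y u : eis).

(** The root runs over residues instead of integers so that the condition is boolean; [extra_rootP]
    reduces an arbitrary integer root to this form. *)
Definition extra_root (p : nat) : pred ('I_K * 'I_K) := fun c =>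
  [exists r : 'I_p, (p %| (r : nat)%:Z ^+ 3 - 1)%Z &&
    edvd p (y * pt Wd C0 c - (r : nat)%:Z%:~R * u)].

Lemma extra_rootP p (r : int) c : prime p -> (p %| r ^+ 3 - 1)%Z ->
  edvd p (y * pt Wd C0 c - r%:~R * u) -> extra_root p c.
Proof.
move=> pp h1 h2; have p0 : (0 < p)%N := prime_gt0 pp.
have pz : p%:Z != 0 by rewrite eqz_nat -lt0n.
have rlt : (`|(r %% p)%Z| < p)%N.
  by rewrite -ltz_nat gez0_abs ?modz_ge0 // ltz_pmod.
have hr : (p %| r - (`|(r %% p)%Z|%N)%:Z)%Z.
  rewrite gez0_abs ?modz_ge0 // {1}(divz_eq r p) addrK.
  exact: dvdz_mull.
apply/existsP; exists (Ordinal rlt) => /=.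
set r' := (`|(r %% p)%Z|%N)%:Z in hr *.
apply/andP; split.
  have -> : r' ^+ 3 - 1 = (r ^+ 3 - 1) - (r - r') * (r ^+ 2 + r * r' + r' ^+ 2) by ring.
  by apply: dvdzB => //; exact: dvdz_mulr.
have -> : y * pt Wd C0 c - r'%:~R * u =
   (y * pt Wd C0 c - r%:~R * u) + (r - r')%:~R * u by ring.
by apply: edvdD => //; apply: edvdMr; rewrite edvd_intr.
Qed.

Definition root_class (p : nat) (r : int) : pred ('I_K * 'I_K) := fun c =>
  edvd p (y * pt Wd C0 c - r%:~R * u).

Lemma card_root_class p r : prime p -> coprime p Wd -> coprime p (nnorm y) ->
  (#|root_class p r| <= (K %/ p + 1) ^ 2)%N.
Proof.
move=> pp cW cy; have p0 := prime_gt0 pp; apply: card_cell2.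
move=> [x1 x2] [y1 y2] /= h1 h2 e1 e2.
have : edvd p (pt Wd C0 (x1, x2) - pt Wd C0 (y1, y2)).
  apply: (@edvd_Gauss _ y); first by rewrite -nnormE coprimezE.
  have -> : y * (pt Wd C0 (x1, x2) - pt Wd C0 (y1, y2)) =
    (y * pt Wd C0 (x1, x2) - r%:~R * u) - (y * pt Wd C0 (y1, y2) - r%:~R * u) by ring.
  exact: edvdB.
move=> /andP[]; rewrite !eisE /= => g1 g2.
have fin (a : int) (i j : 'I_K) : (i %/ p = j %/ p)%N ->
    (p %| a + Wd%:Z * i%:Z - (a + Wd%:Z * j%:Z))%Z -> i = j.
  move=> hij; have -> : a + Wd%:Z * i%:Z - (a + Wd%:Z * j%:Z) =
     Wd%:Z * (i%:Z - j%:Z) by ring.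
  rewrite Gauss_dvdzr // => /dvdz_small; move/(_ (divn_eq_absz p0 hij)).
  by move=> h; apply: val_inj; apply/eqP; rewrite -eqz_nat -subr_eq0 h.
by rewrite (fin _ _ _ e1 g1) (fin _ _ _ e2 g2).
Qed.

(** There are at most three cube roots of unity modulo p, and each of them fixes the point modulo p
    because y is invertible. *)
Lemma card_extra_root p : prime p -> coprime p Wd -> coprime p (nnorm y) ->
  (#|extra_root p| <= 3 * (K %/ p + 1) ^ 2)%N.
Proof.
move=> pp cW cy.
have cls r r' : (p %| r - r')%Z -> subpred (root_class p r) (root_class p r').
  move=> h c hc; rewrite /root_class.
  have -> : y * pt Wd C0 c - r'%:~R * u =
    (y * pt Wd C0 c - r%:~R * u) + (r - r')%:~R * u by ring.
  by apply: edvdD => //; apply: edvdMr; rewrite edvd_intr.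
pose f (r : int) : int := r ^+ 2 + r + 1.
have three r1 r2 r3 : (forall c, extra_root p c ->
    [|| root_class p r1 c, root_class p r2 c | root_class p r3 c]) ->
    (#|extra_root p| <= 3 * (K %/ p + 1) ^ 2)%N.
  move=> h.
  apply: (@leq_trans #|[predU root_class p r1 & [predU root_class p r2 & root_class p r3]]|).
    by apply: subset_leq_card; apply/fintype.subsetP => c; exact: h.
  apply: (@leq_trans (#|root_class p r1| + (#|root_class p r2| + #|root_class p r3|))).
    apply: (@leq_trans (#|root_class p r1| + #|[predU root_class p r2 & root_class p r3]|)).
      by rewrite -cardUI leq_addr.
    by rewrite leq_add2l -cardUI leq_addr.
  have b r := card_root_class r pp cW cy.
  by have := b r1; have := b r2; have := b r3; lia.
have [r0 hr0|no] := pickP [pred r : 'I_p | (p %| f (r : nat)%:Z)%Z].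
  apply: (three 1 (r0 : nat)%:Z (- 1 - (r0 : nat)%:Z)) => c /existsP[r /andP[h1 h2]].
  case/or3P: (root_cover pp h1 hr0) => h; have := cls _ _ h _ h2 => ->;
    by rewrite ?orbT.
(* Without a root of X^2 + X + 1 modulo p, the only cube root of unity is 1. *)
apply: (three 1 1 1) => c /existsP[r /andP[h1 h2]]; apply/orP; left.
have : (p %| ((r : nat)%:Z - 1) * f (r : nat)%:Z)%Z.
  by have -> : ((r : nat)%:Z - 1) * f (r : nat)%:Z = (r : nat)%:Z ^+ 3 - 1 by rewrite /f; ring.
rewrite dvdzE abszM Euclid_dvdM // -!dvdzE => /orP[h|]; first exact: cls h _ h2.
by have := no r; rewrite /= => ->.
Qed.

End ExactCount.

Lemma sum_exact_le (Q K : nat) : (0 < K)%N ->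
  \sum_(0 <= p < Q | (P0 < p)%N) 12 * K%:R ^+ 2 * (p%:R^-1) ^+ 2 <= K%:R ^+ 2 / 100 :> R.
Proof.
move=> K0; rewrite -mulr_sumr.
have Lr : (0 : R) <= 12 * K%:R ^+ 2 by apply: mulr_ge0 => //; exact: sqr_ge0.
have := ler_wpM2l Lr (le_trans (sum_inv_sqr_le Q P0_gt0) P0r).
by move/le_trans; apply; have := sqr_ge0 (K%:R : R); lra.
Qed.

(** For p <= P1 <= K the bound 3 (K / p + 1)^2 is at most 12 K^2 / p^2, which is summable over p >
    P0. This is why [exact_] only concerns primes up to P. *)
Lemma exact_count (P1 Wd d n K : nat) C0 y u : (P1 <= K)%N -> (0 < K)%N ->
  Wd = (W * d)%N -> n = nnorm y ->
  (#|[pred c : 'I_K * 'I_K | has (fun p => (prime p && coprime p (W * d * n)) &&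
    extra_root Wd C0 y u p c) (index_iota 0 P1.+1)]|%:R : R) <= K%:R ^+ 2 / 100.
Proof.
move=> PK K0 eW en; apply: le_trans (sum_exact_le P1.+1 K0).
apply: le_trans (_ : \sum_(p <- index_iota 0 P1.+1 | prime p && coprime p (W * d * n))
   12 * K%:R ^+ 2 * (p%:R^-1) ^+ 2 <= _).
  apply: (union_bound (B := extra_root Wd C0 y u)) => p.
  rewrite mem_index_iota ltnS /= => pP /andP[pp]; rewrite coprimeMr => /andP[cW cn].
  rewrite -eW in cW; rewrite en in cn.
  have := card_extra_root K C0 u pp cW cn; rewrite -(ler_nat R) => /le_trans; apply.
  have p0 := prime_gt0 pp; have pr : (0 : R) < p%:R by rewrite ltr0n.
  have d1 := divn_le_ratr K p0.
  have k1 : (1 : R) <= K%:R / p%:R.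
    by rewrite ler_pdivlMr // mul1r ler_nat (leq_trans pP).
  rewrite natrM natrX natrD.
  have -> : 12 * K%:R ^+ 2 * (p%:R^-1) ^+ 2 = 12 * (K%:R / p%:R) ^+ 2 :> R.
    by rewrite exprMn [in RHS]mulrA.
  have a0 : (0 : R) <= (K %/ p)%N%:R by [].
  move: d1 k1 a0; move: ((K %/ p)%N%:R : R) (K%:R / p%:R : R) => a b h1 h2 a0.
  have : (a + 1) ^+ 2 <= (2 * b) ^+ 2 by rewrite ler_sqr ?nnegrE; lra.
  by rewrite !expr2; lra.
rewrite big_mkcond [leRHS]big_mkcond /=; apply: ler_sum => p _.
have h0 : 0 <= 12 * K%:R ^+ 2 * (p%:R^-1 : R) ^+ 2.
  by apply: mulr_ge0; [apply: mulr_ge0 => //; exact: sqr_ge0|exact: sqr_ge0].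
case: ifP => [/andP[pp]|_]; last by case: ifP.
by rewrite !coprimeMr => /andP[/andP[cW _] _]; rewrite P0W.
Qed.

Section FirstBlock.
Variable X : nat.
Hypothesis DX : (D <= X)%N.

Lemma card_lin_blk (q : nat) : (0 < q)%N -> coprime q W ->
  (#|[pred x : 'I_X | q %| lin_blk W x]%N|%:R : R) <= X%:R / q%:R + 1.
Proof.
move=> q0 cq; apply: le_trans (_ : (X %/ q + 1)%N%:R <= _); last first.
  by rewrite natrD lerD2r divn_le_ratr.
rewrite ler_nat; apply: leq_trans (card_lin X (1 + W%:Z * X%:Z) q0 cq).
apply: subset_leq_card; apply/fintype.subsetP => x; rewrite !inE /in_mem /= /lin_dvd.
rewrite dvdzE => h; suff -> : 1 + W%:Z * X%:Z + W%:Z * x%:Z = (lin_blk W x)%:Z by [].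
by rewrite /lin_blk PoszD PoszM PoszD; ring.
Qed.

Lemma X_ge : 200 * 100 * (W%:R : R) <= X%:R.
Proof. by apply: (le_trans WD); rewrite ler_nat. Qed.

Lemma lin_blk_sq_count :
  (#|[pred x : 'I_X | ~~ sqfreeb (lin_blk W x)]|%:R : R) <= X%:R / 20.
Proof.
pose c p := prime p && (P0 < p)%N && coprime p W.
pose F (p : nat) : R := X%:R * (p%:R^-1) ^+ 2 + 1.
(* If p^2 divides a number at most 2 W X and X >= 20000 W, then p <= X / 100; the terms 1 of F thus
   add up to about X / 100. *)
pose Q := (X %/ 100).+1.
apply: le_trans (_ : \sum_(p <- index_iota 0 Q | c p) F p <= _).
  apply: le_trans (@union_bound _ (index_iota 0 Q) c
    (fun p => [pred x : 'I_X | p * p %| lin_blk W x]%N) F _); last first.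
    move=> p _ /andP[/andP[pp P0p] cp]; have p0 := prime_gt0 pp.
    have q0 : (0 < p * p)%N by rewrite muln_gt0 p0.
    have cq : coprime (p * p) W by rewrite coprimeMl cp.
    by have := card_lin_blk q0 cq; rewrite /F expr2 -invfM -natrM.
  rewrite ler_nat; apply: subset_leq_card; apply/fintype.subsetP => x; rewrite !inE.
  move=> /allPn[p]; rewrite mem_primes => /and3P[pp m0 pm] /negPn ppm.
  have pin : p \in index_iota 0 Q.
    rewrite mem_index_iota ltnS /= leq_divRL //.
    have h1 : (p * p <= 2 * W * X)%N.
      exact: leq_trans (dvdn_leq m0 ppm) (lin_blk_bounds W_gt0 x).2.
    rewrite -(ler_nat R) natrM -(ler_sqr (x := p%:R * 100)) ?nnegrE ?mulr_ge0 //.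
    move: h1; rewrite -(ler_nat R) !natrM.
    have := ler_wpM2r (ler0n R X) X_ge.
    by rewrite !expr2; move: (p%:R : R) (W%:R : R) (X%:R : R) => a b e; lra.
  have cp : coprime p W by exact: coprime_dvdl pm (lin_blk_coprime W x).
  have cpp : c p && (p * p %| lin_blk W x)%N by rewrite ppm andbT /c pp cp P0W.
  by apply/hasP; exists p; [exact: pin|exact: cpp].
apply: le_trans (_ : \sum_(0 <= p < Q | (P0 < p)%N)
    X%:R * (p%:R^-1) ^+ 2 + \sum_(0 <= p < Q) 1 <= _).
  rewrite big_split /=; apply: lerD.
    rewrite big_mkcond [leRHS]big_mkcond /=; apply: ler_sum => p _; rewrite /c.
    have h0 : 0 <= X%:R * (p%:R^-1 : R) ^+ 2.
      by apply: mulr_ge0 => //; exact: sqr_ge0.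
    by case: (P0 < p)%N; rewrite ?andbF //=; case: ifP.
  by rewrite big_mkcond; apply: ler_sum => p _; case: ifP.
rewrite -mulr_sumr sumr_const_nat subn0 /Q.
have := ler_wpM2l (ler0n R X) (le_trans (sum_inv_sqr_le (X %/ 100).+1 P0_gt0) P0r).
have d1 := divn_le_ratr X (isT : 0 < 100)%N.
have W1 : (1 : R) <= W%:R by rewrite ler1n.
have := X_ge; rewrite -[(X %/ 100).+1%:R]natr1.
move: d1 W1; move: (\sum_(_ <= p < _ | _) _) => S.
by move: (X%:R : R) (W%:R : R) ((X %/ 100)%N%:R : R) => x y z; lra.
Qed.

Definition lin_blk_good (x : 'I_X) :=
  sqfreeb (lin_blk W x) && (recsum D (lin_blk W x) <= 1 / 100).

Lemma lin_blk_count : (X <= 2 * #|lin_blk_good|)%N.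
Proof.
apply: (@half_good _ _ [pred x : 'I_X | ~~ sqfreeb (lin_blk W x)]
  [pred x : 'I_X | ~~ (recsum D (lin_blk W x) <= 1 / 100)] pred0).
- by rewrite card_ord.
- by move=> t; rewrite /lin_blk_good negb_and orbF.
have b1 := lin_blk_sq_count.
have hb2 : forall p : nat, prime p -> coprime p W -> (p <= D)%N ->
   (#|[pred x : 'I_X | p %| lin_blk W x]%N|%:R : R) <= 4 * X%:R / p%:R.
  move=> p pp cp pD; apply: (le_trans (card_lin_blk (prime_gt0 pp) cp)).
  have pr : (0 : R) < p%:R by rewrite ltr0n prime_gt0.
  have : (1 : R) <= X%:R / p%:R.
    by rewrite ler_pdivlMr // mul1r ler_nat (leq_trans pD).
  by lra.
have b2 := recsum_markov (lin_blk_coprime W (L := X)) hb2.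
rewrite card0; move: b1 b2.
move: (#|_|%:R : R) => v; move: (#|_|%:R : R) => w.
by have := ler0n R X; move: (X%:R : R) => x; lra.
Qed.

End FirstBlock.

Lemma lin_solve (a b : int) (m : nat) : coprimez a m ->
  exists x, (m %| a * x - b)%Z.
Proof.
move=> /eqP co; have [u [v h]] := Bezoutz a m; rewrite co in h.
exists (u * b); have -> : a * (u * b) - b = (u * a + v * m%:Z - 1) * b - m%:Z * (v * b).
  by ring.
by rewrite h subrr mul0r sub0r -mulrN dvdz_mulr.
Qed.

Lemma crt (m k : nat) (a b : int) : coprime m k -> (0 < m)%N -> (0 < k)%N ->
  exists c : nat, [/\ (c < m * k)%N, (m %| c%:Z - a)%Z & (k %| c%:Z - b)%Z].
Proof.
move=> co m0 k0; have [x hx] : exists x, (k %| m%:Z * x - (b - a))%Z.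
  exact: lin_solve.
pose c := a + m%:Z * x.
have mk0 : (m * k)%N%:Z != 0 by rewrite eqz_nat -lt0n muln_gt0 m0.
have eqc : (`|(c %% (m * k)%N)%Z|%N)%:Z = (c %% (m * k)%N)%Z.
  by rewrite gez0_abs ?modz_ge0.
have cm : ((m * k)%N %| (c %% (m * k)%N)%Z - c)%Z.
  rewrite {2}(divz_eq c (m * k)%N) opprD addrCA subrr addr0.
  by rewrite -mulNr dvdz_mull.
exists `|(c %% (m * k)%N)%Z|%N; rewrite -ltz_nat !eqc; split.
- by rewrite ltz_pmod // ltz_nat muln_gt0 m0.
- have -> : (c %% (m * k)%N)%Z - a = ((c %% (m * k)%N)%Z - c) + m%:Z * x.
    by rewrite /c; ring.
  apply: dvdzD; last exact: dvdz_mulr.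
  by apply: dvdz_trans cm; rewrite PoszM dvdz_mulr.
have -> : (c %% (m * k)%N)%Z - b =
  ((c %% (m * k)%N)%Z - c) + (m%:Z * x - (b - a)) by rewrite /c; ring.
by apply: dvdzD => //; apply: dvdz_trans cm; rewrite PoszM dvdz_mull.
Qed.

(** * Choice of C once the other data are fixed *)

Section LastBlock.
Variables (P1 K d1 : nat) (dl et A : eis).
Hypotheses (sd1 : sqfree d1) (sdl : sqfree (nnorm dl)) (set_ : sqfree (nnorm et))
  (c1 : coprime d1 (nnorm dl)) (c2 : coprime (d1 * nnorm dl) (nnorm et))
  (d1W : coprime d1 W) (dlW : edvd W (dl - 1)) (etW : edvd W (et - 1))
  (AW : edvd W (A - 1)) (cA : coprime (nnorm A) (d1 * nnorm dl * nnorm et))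
  (A1 : (1 < nnorm A)%N) (dP : (d1 * nnorm dl <= P1)%N) (PK : (P1 <= K)%N)
  (DK : (D <= K)%N) (gl : (size (primes (nnorm et * nnorm A)) <= l)%N)
  (rg : recsum D (nnorm et * nnorm A) <= 2 / 100).

(** The congruences C = w modulo W and conj eta C = r eta A modulo d = d1 N(dl) are met on one class
    C0 modulo W d. Inside this class, failure of coprimality has proportion at most 9 / 100 and an
    extra root at most 1 / 100. *)
Lemma last_count : exists C0 : eis, [/\
  0 <= re C0 < (W * (d1 * nnorm dl))%N%:Z, 0 <= om C0 < (W * (d1 * nnorm dl))%N%:Z &
  exists G : pred ('I_K * 'I_K), (K * K <= 2 * #|G|)%N /\
   forall c, G c -> valid W P1 d1 dl et A (pt (W * (d1 * nnorm dl)) C0 c)].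
Proof.
have d10 := sqfree_gt0 sd1; have e0 := sqfree_gt0 sdl; have n0 := sqfree_gt0 set_.
pose e := nnorm dl; pose d := (d1 * e)%N; pose n := nnorm et.
have d0 : (0 < d)%N by rewrite muln_gt0 d10.
have eW : coprime e W by exact: norm_mod1.
have nW : coprime n W by exact: norm_mod1.
have dW : coprime d W by rewrite coprimeMl d1W.
(* r is built by the Chinese remainder theorem: it is 1 modulo d1 and the root x1 = - re dl / om dl
   modulo e. *)
have [x1 hx1] : exists x, (e %| om dl * x - (- re dl))%Z.
  by apply: lin_solve; rewrite /coprimez gcdzC; exact: dl_coprime.
have [k hk] : exists k, (e %| d1%:Z * k - (x1 - 1))%Z by exact: lin_solve.
pose r := 1 + d1%:Z * k.
have r1 : (d1 %| r - 1)%Z by rewrite /r addrAC subrr add0r dvdz_mulr.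
have r2 : (e %| re dl + om dl * r)%Z.
  have -> : re dl + om dl * r = (om dl * x1 - (- re dl)) +
     om dl * (d1%:Z * k - (x1 - 1)) by rewrite /r; ring.
  by apply: dvdzD => //; exact: dvdz_mull.
have [n' hn'] : exists n', (d %| n%:Z * n' - 1)%Z.
  by apply: lin_solve; rewrite coprimezE coprime_sym.
(* As n n' = 1 modulo d, this solves conj eta T = r eta A modulo d. *)
pose T := (r * n')%:~R * (et * et * A).
have cWd : coprime W d by rewrite coprime_sym.
have [a [a1 a2 a3]] := crt 0 (re T) cWd W_gt0 d0.
have [b [b1 b2 b3]] := crt 1 (om T) cWd W_gt0 d0.
pose C0 := Eis a%:Z b%:Z; exists C0.
split; rewrite ?ltz_nat //=.
pose C (c : 'I_K * 'I_K) := pt (W * d) C0 c.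
pose u := et * A; pose y := conj et.
pose B1 := [pred c : 'I_K * 'I_K | ~~ coprime (nnorm (C c)) (n * nnorm A)].
pose B2 := [pred c : 'I_K * 'I_K | has (fun p => (prime p && coprime p (W * d * n)) &&
    extra_root (W * d) C0 y u p c) (index_iota 0 P1.+1)].
exists [pred c | ~~ B1 c && ~~ B2 c]; split.
  apply: (@half_good _ _ B1 B2 pred0).
  - by rewrite card_prod !card_ord.
  - by move=> c; rewrite /= negb_and !negbK orbF.
  have K0 : (0 < K)%N by exact: leq_trans DK.
  have b2' := @exact_count P1 (W * d) d n K C0 y u PK K0 erefl (esym (nnorm_conj et)).
  have g0 : (0 < n * nnorm A)%N by rewrite muln_gt0 n0 ltnW.
  have cg : coprime (n * nnorm A) (W * d).
    rewrite coprimeMr; apply/andP; split; rewrite coprimeMl.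
      by rewrite nW norm_mod1.
    by rewrite coprime_sym c2; apply: coprime_dvdr cA; exact: dvdn_mulr.
  have b1' := not_coprime_count C0 D_gt0 DK g0 cg gl.
  have D0r : (0 : R) < D%:R by rewrite ltr0n.
  have lD' : l%:R / D%:R <= 1 / (4 * 100) :> R.
    by rewrite ler_pdivrMr //; move: lD; lra.
  have Kr : (0 : R) <= 4 * K%:R ^+ 2 by apply: mulr_ge0 => //; exact: sqr_ge0.
  have b1'' : (#|B1|%:R : R) <= 4 * K%:R ^+ 2 * (2 / 100 + 1 / (4 * 100)).
    exact: le_trans b1' (ler_wpM2l Kr (lerD rg lD')).
  have b2'' : (#|B2|%:R : R) <= K%:R ^+ 2 / 100 by exact: b2'.
  rewrite card0 natrM; have := sqr_ge0 (K%:R : R); move: b1'' b2''; rewrite !expr2.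
  by move: (#|B1|%:R : R) (#|B2|%:R : R) (K%:R : R) => v w x; lra.
move=> c /andP[/negPn gC nB2]; rewrite -/(C c).
have Cd (m : nat) (z : eis) : (m %| W * d)%N -> (m %| re C0 - re z)%Z ->
    (m %| om C0 - om z)%Z -> edvd m (C c - z).
  move=> hm h1 h2; rewrite /edvd !eisE /C /pt /=.
  have h (s : nat) : (m %| (W * d)%N%:Z * s%:Z)%Z by rewrite dvdz_mulr.
  by apply/andP; split; rewrite addrAC dvdzD.
have CW : edvd W (C c - Eis 0 1) by apply: Cd => //; exact: dvdn_mulr.
have CT : edvd d (C c - T) by apply: Cd => //; exact: dvdn_mull.
split=> //.
- exists r; split => //; rewrite -/d -/n -/e.
  have -> : conj et * C c - r%:~R * (et * A) =
     conj et * (C c - T) + (r%:~R * (et * A)) * (n%:Z * n' - 1)%:~R.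
    rewrite /T nnormE; have -> : (norm et * n' - 1)%:~R =
      et * conj et * n'%:~R - 1 :> eis by rewrite mul_conj; ring.
    by ring.
  apply: edvdD; first exact: edvdMl.
  by apply: edvdMl; rewrite edvd_intr.
move=> p r' pp pP npd h3; apply/negP => he; case/negP: nB2.
apply/hasP; exists p; first by rewrite mem_index_iota.
by rewrite pp prime_coprime // npd; exact: extra_rootP he.
Qed.

End LastBlock.

End Block.

End Counting.

(** * Boxes of data *)

Lemma card_dep (S T : finType) (P : pred S) (Q : S -> pred T) (m k c c' : nat) :
  (m <= c * #|P|)%N -> (forall s, P s -> (k <= c' * #|Q s|)%N) ->
  (m * k <= c * c' * #|[pred t : S * T | P t.1 && Q t.1 t.2]|)%N.
Proof.
move=> hm hk.
have -> : #|[pred t : S * T | P t.1 && Q t.1 t.2]| = (\sum_(s in P) #|Q s|)%N.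
  rewrite -sum1_card (eq_bigr (fun s => \sum_(t | Q s t) 1)%N); last first.
    by move=> s _; rewrite sum1_card.
  by rewrite pair_big_dep.
apply: (leq_trans (leq_mul hm (leqnn k))).
rewrite -[leqRHS]mulnA -[leqLHS]mulnA leq_mul2l; apply/orP; right.
rewrite big_distrr /= -sum_nat_const; apply: leq_sum => s; exact: hk.
Qed.

Section Box.
Variables (R : realFieldType) (P0 W D l : nat).
Hypotheses (P0_gt0 : (0 < P0)%N) (P0r : (P0%:R : R)^-1 <= 1 / (40 * 100))
  (W_gt2 : (2 < W)%N) (W3 : (3 %| W)%N)
  (P0W : forall p, prime p -> coprime p W -> (P0 < p)%N)
  (D_gt0 : (0 < D)%N) (WD : (200 * 100 * W%:R : R) <= D%:R)
  (lD : (4 * 100 * l%:R : R) <= D%:R).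
Variables (X1 X2 X3 K P : nat).
(** The bound (2 W X1) (2 W X2)^2 for d1 N(dl). *)
Definition dmax := (8 * W ^ 3 * X1 * X2 ^ 2)%N.
(** The two sides are chosen so that A and C have coordinates of the same order W dmax K. *)
Definition sideA := (dmax * K)%N.
Definition sideC := (W * dmax * K)%N.
Hypotheses (DX1 : (D <= X1)%N) (DX2 : (D <= X2)%N) (DX3 : (D <= X3)%N)
  (dmaxP : (dmax <= P)%N) (PK : (P <= K)%N)
  (lbig : (dmax * (2 * W * X3) ^ 2 * (2 * W * sideA) ^ 2 < 2 ^ l.+1)%N).

Definition box := ('I_X1 * ('I_X2 * 'I_X2) * ('I_X3 * 'I_X3) *
  ('I_sideA * 'I_sideA) * ('I_sideC * 'I_sideC))%type.
Definition box_d1 (t : box) := lin_blk W t.1.1.1.1.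
Definition box_dl (t : box) := blk W t.1.1.1.2.
Definition box_et (t : box) := blk W t.1.1.2.
Definition box_A (t : box) := blk W t.1.2.
Definition box_C (t : box) := Eis (t.2.1 : nat)%:Z (t.2.2 : nat)%:Z.

Definition box_valid (t : box) :=
  `[< valid W P (box_d1 t) (box_dl t) (box_et t) (box_A t) (box_C t) >].

Let W_gt0 : (0 < W)%N. Proof. exact: ltn_trans W_gt2. Qed.
Let D_dmax : (D <= dmax)%N.
Proof.
apply: (leq_trans DX1); rewrite /dmax.
have X2_gt0 : (0 < X2)%N by exact: leq_trans DX2.
by rewrite mulnAC leq_pmull // !muln_gt0 ?expn_gt0 ?W_gt0 ?X2_gt0.
Qed.
Let DK : (D <= K)%N.
Proof. exact: leq_trans D_dmax (leq_trans dmaxP PK). Qed.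
Let K_gt0 : (0 < K)%N. Proof. exact: leq_trans DK. Qed.
Let dmax_gt0 : (0 < dmax)%N. Proof. exact: leq_trans D_dmax. Qed.
Let D_sideA : (D <= sideA)%N.
Proof. by apply: (leq_trans D_dmax); rewrite leq_pmulr. Qed.

Lemma size_primes_le (g : nat) : (0 < g)%N ->
  (g <= dmax * (2 * W * X3) ^ 2 * (2 * W * sideA) ^ 2)%N ->
  (size (primes g) <= l)%N.
Proof.
move=> g0 hg; rewrite -ltnS -(ltn_exp2l _ _ (isT : 1 < 2)%N).
exact: leq_ltn_trans (leq_trans (two_exp_size_primes g0) hg) lbig.
Qed.

Lemma d_le_dmax (x : 'I_X1) (t : 'I_X2 * 'I_X2) :
  (lin_blk W x * nnorm (blk W t) <= dmax)%N.
Proof.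
apply: leq_trans (leq_mul (lin_blk_bounds W_gt0 x).2 (blk_norm W_gt0 t).2) _.
by rewrite /dmax !expnMn; apply: eq_leq; ring.
Qed.

(** d1, dl, eta, A and C are chosen in turn, each choice losing at most a factor 2, whence 32. C
    contributes K^2 only, being confined to one class modulo W d1 N(dl). *)
Lemma box_count :
  (X1 * (X2 * X2) * (X3 * X3) * (sideA * sideA) * (K * K) <= 32 * #|box_valid|)%N.
Proof.
have s1 := lin_blk_count P0_gt0 P0r W_gt0 P0W WD DX1.
have cw1 (x : 'I_X1) : coprime (lin_blk W x) W by exact: lin_blk_coprime.
have cw (L : nat) (t : 'I_L * 'I_L) : coprime (nnorm (blk W t)) W.
  exact: norm_mod1 (blk_W W t).
have lin0 (x : 'I_X1) : (0 < lin_blk W x)%N by rewrite /lin_blk.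
have big3 (X : nat) (t : 'I_X * 'I_X) : (nnorm (blk W t) <= (2 * W * X) ^ 2)%N.
  exact: (blk_norm W_gt0 t).2.
have e0 : (0 < (2 * W * X3) ^ 2)%N.
  by rewrite expn_gt0 !muln_gt0 W_gt0 (leq_trans D_gt0 DX3).
have f0 : (0 < (2 * W * sideA) ^ 2)%N.
  by rewrite expn_gt0 muln_gt0 (leq_trans D_gt0 D_sideA) andbT muln_gt0 W_gt0.
have s2 : forall x : 'I_X1, lin_blk_good R W D x ->
    (X2 * X2 <= 2 * #|blk_good R W D (L := X2) (lin_blk W x)|)%N.
  move=> x /andP[_ rx]; apply: (blk_count P0_gt0 P0r W_gt0 W3 P0W D_gt0 WD lD) => //.
    apply: size_primes_le => //.
    have h := d_le_dmax x (Ordinal (leq_trans D_gt0 DX2), Ordinal (leq_trans D_gt0 DX2)).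
    rewrite -mulnA; apply: leq_trans (leq_pmulr _ _); last by rewrite muln_gt0 e0.
    by apply: leq_trans h; rewrite leq_pmulr // (blk_gt0 W_gt0).
  by move: rx; move: (recsum _ _ _) => a; lra.
have t2 := card_dep s1 s2.
have s3 : forall s : 'I_X1 * ('I_X2 * 'I_X2),
    lin_blk_good R W D s.1 && blk_good R W D (lin_blk W s.1) s.2 ->
    (X3 * X3 <= 2 * #|blk_good R W D (L := X3) (lin_blk W s.1 * nnorm (blk W s.2))|)%N.
  move=> [x t] /= /andP[/andP[_ rx] /and3P[_ rt _]].
  apply: (blk_count P0_gt0 P0r W_gt0 W3 P0W D_gt0 WD lD) => //.
  - by rewrite muln_gt0 lin0 (blk_gt0 W_gt0).
  - by rewrite coprimeMl cw1 cw.
  - apply: size_primes_le; first by rewrite muln_gt0 lin0 (blk_gt0 W_gt0).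
    apply: (leq_trans (d_le_dmax x t)); rewrite -mulnA leq_pmulr //.
    by rewrite muln_gt0 e0.
  have := recsumM R D (lin_blk W x) (nnorm (blk W t)).
  by move: rx rt; move: (recsum _ _ _) => a; move: (recsum _ _ _) => b;
    move: (recsum _ _ _) => e; lra.
have t3 := card_dep t2 s3.
(* Each good factor contributes at most 1 / 100 to [recsum], so the product of three stays within
   the 3 / 100 allowed by [blk_count]. *)
pose g4 (s : 'I_X1 * ('I_X2 * 'I_X2) * ('I_X3 * 'I_X3)) :=
  (lin_blk W s.1.1 * nnorm (blk W s.1.2) * nnorm (blk W s.2))%N.
have s4 : forall s, (lin_blk_good R W D s.1.1 && blk_good R W D (lin_blk W s.1.1) s.1.2)
    && blk_good R W D (lin_blk W s.1.1 * nnorm (blk W s.1.2)) s.2 ->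
    (sideA * sideA <= 2 * #|blk_good R W D (L := sideA) (g4 s)|)%N.
  move=> [[x t] t'] /= /andP[/andP[/andP[_ rx] /and3P[_ rt _]] /and3P[_ rt' _]].
  have gp : (0 < g4 (x, t, t'))%N by rewrite /g4 /= !muln_gt0 lin0 !(blk_gt0 W_gt0).
  apply: (blk_count P0_gt0 P0r W_gt0 W3 P0W D_gt0 WD lD) => //.
  - by rewrite !coprimeMl cw1 !cw.
  - apply: size_primes_le => //; rewrite /g4 /=.
    apply: leq_trans (leq_mul (d_le_dmax x t) (big3 _ t')) _.
    by rewrite leq_pmulr.
  have := recsumM R D (lin_blk W x) (nnorm (blk W t)).
  have := recsumM R D (lin_blk W x * nnorm (blk W t)) (nnorm (blk W t')).
  rewrite /g4 /=; move: rx rt rt'; move: (recsum _ _ _) => a; move: (recsum _ _ _) => b.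
  move: (recsum _ _ _) => e; move: (recsum _ _ _) => f; move: (recsum _ _ _) => h.
  by lra.
have t4 := card_dep t3 s4.
pose Q5 (s : 'I_X1 * ('I_X2 * 'I_X2) * ('I_X3 * 'I_X3) * ('I_sideA * 'I_sideA)) :
  pred ('I_sideC * 'I_sideC) := fun c => box_valid (s, c).
have s5 : forall s, ((lin_blk_good R W D s.1.1.1 && blk_good R W D (lin_blk W s.1.1.1) s.1.1.2)
    && blk_good R W D (lin_blk W s.1.1.1 * nnorm (blk W s.1.1.2)) s.1.2)
    && blk_good R W D (g4 s.1) s.2 -> (K * K <= 2 * #|Q5 s|)%N.
  move=> [[[x t] t'] t''] /=.
  move=> /andP[/andP[/andP[/andP[sx rx] /and3P[st rt ct]] /and3P[st' rt' ct']] /and3P[_ rt'' ct'']].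
  rewrite /g4 /= in ct''.
  set d1 := lin_blk W x in sx rx ct ct' ct'' *; set dl := blk W t in st rt ct ct' ct'' *.
  set et := blk W t' in st' rt' ct' ct'' *; set A := blk W t'' in rt'' ct''.
  have A1 : (1 < nnorm A)%N.
    have [h _] := blk_norm W_gt0 t''.
    have : (2 <= W * sideA)%N.
      by apply: leq_trans (leq_pmulr _ _); [exact: ltnW|exact: leq_trans D_sideA].
    move: h; rewrite -/A -mulnn; move: (W * sideA)%N (nnorm A) => a b h1 h2.
    by move: h1 h2 (leq_mul h2 h2); clear; lia.
  have [] := last_count P0_gt0 P0r W_gt0 W3 P0W D_gt0 WD lD (P1 := P) (K := K)
    (d1 := d1) (dl := dl) (et := et) (A := A).
  all: try by [].
  - exact: sqfreebP (lin0 x) sx.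
  - exact: sqfreebP (blk_gt0 W_gt0 t) st.
  - exact: sqfreebP (blk_gt0 W_gt0 t') st'.
  - by rewrite coprime_sym.
  - by rewrite coprime_sym.
  - exact: cw1.
  - exact: blk_W.
  - exact: blk_W.
  - exact: blk_W.
  - exact: leq_trans (d_le_dmax _ _) dmaxP.
  - apply: size_primes_le; first by rewrite muln_gt0 !(blk_gt0 W_gt0).
    apply: leq_trans (leq_mul (big3 _ t') (big3 _ t'')) _.
    by rewrite -[leqRHS]mulnA leq_pmull.
  - have := recsumM R D (nnorm et) (nnorm A).
    move: rt' rt''; move: (recsum _ _ _) => a; move: (recsum _ _ _) => b.
    by move: (recsum _ _ _) => e; lra.
  move=> C0 [/andP[a0 a1] /andP[b0 b1] [G [hG vG]]].
  apply: (leq_trans hG); rewrite leq_mul2l /=.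
  pose Wd := (W * (d1 * nnorm dl))%N.
  have Wd0 : (0 < Wd)%N by rewrite !muln_gt0 W_gt0 lin0 (blk_gt0 W_gt0).
  (* The points C0 + Wd c have coordinates below Wd K <= [sideC], so they embed in a box that does
     not depend on the other data. *)
  have side (a : int) (c : 'I_K) : 0 <= a -> a < Wd%:Z -> (`|(a + Wd%:Z * c%:Z)%R|%N < sideC)%N.
    move=> ha0 ha1; rewrite -ltz_nat gez0_abs ?addr_ge0 ?mulr_ge0 //.
    have h1 : Wd%:Z * c%:Z <= Wd%:Z * (K%:Z - 1).
      by rewrite ler_wpM2l //; have := ltn_ord c; clear; lia.
    have h2 : (Wd * K <= sideC)%N.
      by rewrite leq_mul2r leq_mul2l d_le_dmax !orbT.
    move: h1 h2; rewrite mulrBr mulr1 -lez_nat PoszM; move: ha1; clear; lia.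
  pose f (c : 'I_K * 'I_K) := (Ordinal (side _ c.1 a0 a1), Ordinal (side _ c.2 b0 b1)).
  have fE c : pt Wd C0 c = Eis (f c).1%:Z (f c).2%:Z.
    by apply: eis_eq; rewrite /= gez0_abs ?addr_ge0 ?mulr_ge0.
  have finj : injective f.
    move=> [c1 c2] [c1' c2'] h.
    have := fE (c1, c2); rewrite h -fE /pt => -[h1 h2].
    have W0 : Wd%:Z != 0 by rewrite eqz_nat -lt0n.
    have {}h1 := mulfI W0 (addrI _ h1); have {}h2 := mulfI W0 (addrI _ h2).
    by congr (_, _); apply: val_inj; apply/eqP; rewrite -eqz_nat; apply/eqP.
  rewrite -(fintype.card_image finj); apply: subset_leq_card; apply/fintype.subsetP => y /fintype.imageP[c Gc ->].
  apply/asboolP; have := vG c Gc; rewrite -/Wd fE; exact.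
have := card_dep t4 s5 => /leq_trans; apply.
rewrite (_ : 2 * 2 * 2 * 2 * 2 = 32)%N // leq_mul2l /=.
apply: subset_leq_card; apply/fintype.subsetP => -[s c] /andP[_ h]; exact: h.
Qed.

End Box.

(** * Size, divisibility and nondegeneracy of nu *)

Definition ebound (M : int) z := (`|re z| <= M) && (`|om z| <= M).

Lemma ebound_ge0 M z : ebound M z -> 0 <= M.
Proof. by move=> /andP[h _]; exact: le_trans h. Qed.

Lemma eboundM M N z t : ebound M z -> ebound N t -> ebound (3 * M * N) (z * t).
Proof.
move=> bz bt; have M0 := ebound_ge0 bz; have N0 := ebound_ge0 bt.
move: bz bt => /andP[a b] /andP[c d].
have h (x y : int) : `|x| <= M -> `|y| <= N -> `|x * y| <= M * N.
  by move=> hx hy; rewrite normrM ler_pM.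
have := h _ _ a c; have := h _ _ a d; have := h _ _ b c; have := h _ _ b d.
have : 0 <= M * N by rewrite mulr_ge0.
rewrite /ebound !eisE -mulrA; move: (re z * re t) (re z * om t) (om z * re t) (om z * om t).
by move: (M * N); clear; lia.
Qed.

Lemma ebound_conj M z : ebound M z -> ebound (2 * M) (conj z).
Proof. by rewrite /ebound !eisE; clear; lia. Qed.

Lemma ebound_norm M z : ebound M z -> norm z <= 3 * M ^+ 2.
Proof.
move=> bz; have M0 := ebound_ge0 bz; move: bz => /andP[a b].
have h (x y : int) : `|x| <= M -> `|y| <= M -> `|x * y| <= M * M.
  by move=> hx hy; rewrite normrM ler_pM.
have := h _ _ a a; have := h _ _ a b; have := h _ _ b b.
rewrite /norm !expr2; move: (re z * re z) (re z * om z) (om z * om z) (M * M).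
by clear; lia.
Qed.

Lemma ebound_nu U u v : ebound U u -> ebound U v ->
  ebound (12 * U ^+ 3) (conj u * (norm u)%:~R - conj v * (norm v)%:~R).
Proof.
move=> bu bv; have U0 := ebound_ge0 bu.
have h z : ebound U z -> ebound (6 * U ^+ 3) (conj z * (norm z)%:~R).
  move=> bz; have /andP[a b] := ebound_conj bz.
  have c := ebound_norm bz; have c0 := norm_ge0 z.
  have key (x : int) : `|x| <= 2 * U -> `|x * norm z| <= 6 * U ^+ 3.
    move=> hx; rewrite normrM (ger0_norm c0).
    have -> : 6 * U ^+ 3 = (2 * U) * (3 * U ^+ 2) by ring.
    exact: ler_pM.
  by rewrite /ebound !eisE !mulr0 subr0 add0r subr0; rewrite !eisE in a b; rewrite !key.
have := h u bu; have := h v bv; rewrite /ebound; rewrite !reD !omD !reN !omN.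
move: (re _) (om _) (re _) (om _) => x y z t; move: (U ^+ 3); clear; lia.
Qed.

(** nu has coordinates at most 12 U^3; the factor u or v brings this to 36 U^4, and [kap] costs
    another factor 3. *)
Lemma point_bound U u v t (m : int) : 0 <= m -> ebound U u -> ebound U v ->
  conj u * (norm u)%:~R - conj v * (norm v)%:~R = m%:~R * t ->
  ebound (108 * U ^+ 4) (m%:~R * (kap * (u * t))) /\
  ebound (108 * U ^+ 4) (m%:~R * (kap * (v * t))).
Proof.
move=> m0 bu bv h; have bn := ebound_nu bu bv; rewrite h in bn.
have bk z : ebound U z -> ebound (108 * U ^+ 4) (m%:~R * (kap * (z * t))).
  move=> bz; have := eboundM bz bn.
  have -> : m%:~R * (kap * (z * t)) = kap * (z * (m%:~R * t)) by ring.
  have -> : 108 * U ^+ 4 = 3 * (3 * U * (12 * U ^+ 3)) by ring.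
  move: (3 * U * (12 * U ^+ 3)) (z * (m%:~R * t)) => M s.
  rewrite /ebound !reM !omM /kap /=; clear; lia.
by split; apply: bk.
Qed.

Lemma edvd_div (k : int) z : edvd k z ->
  z = k%:~R * Eis (re z %/ k)%Z (om z %/ k)%Z.
Proof.
move=> /andP[h1 h2]; apply: eis_eq.
  by rewrite reM re_intr om_intr mul0r subr0 mulrC divzK.
by rewrite omM re_intr om_intr !mul0r addr0 subr0 mulrC divzK.
Qed.

(** The norm of conj z N(z) is N(z)^3, and cubing is injective. *)
Lemma conj_norm_inj z t :
  conj z * (norm z)%:~R = conj t * (norm t)%:~R -> norm z = norm t.
Proof.
move=> h; have := congr1 norm h; rewrite !normM !norm_conj !norm_intr -!exprS.
by move=> /eqP; rewrite eqrXn2 ?norm_ge0 // => /eqP.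
Qed.

Section Solution.
Variables (W P : nat).
Hypotheses (W2 : (2 < W)%N) (W3 : (3 %| W)%N).
Variables (d1 : nat) (dl et A C : eis).
Hypothesis V : valid W P d1 dl et A C.
Let u := et * A.
Let v := conj et * C.
Let m := (nnorm et * (d1 * nnorm dl))%N.

(** n divides N(u) and N(v). Modulo d1 N(dl), v = r u and conj v = r conj u with r rational, so conj
    v N(v) = r^3 conj u N(u) with r^3 = 1. *)
Lemma valid_nu_dvd : edvd m (conj u * (norm u)%:~R - conj v * (norm v)%:~R).
Proof.
have [r [hr hr1 hr2]] := root V.
have q := dl_root (sq_dl V) hr2 (dl_coprime (sq_dl V)).
rewrite /m PoszM; apply: edvd_mul_coprime.
- by rewrite coprimezE coprime_sym; exact: co_d_et V.
- rewrite /u /v !normM norm_conj -(nnormE et).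
  have -> : conj (et * A) * ((nnorm et)%:Z * norm A)%:~R -
      conj (conj et * C) * ((nnorm et)%:Z * norm C)%:~R =
    (nnorm et)%:Z%:~R * (conj (et * A) * (norm A)%:~R -
      conj (conj et * C) * (norm C)%:~R) by ring.
  by apply/edvdP; eexists.
have r3 : ((d1 * nnorm dl)%N %| r ^+ 3 - 1)%Z.
  have -> : r ^+ 3 - 1 = (r - 1) * (r ^+ 2 + r + 1) by ring.
  by rewrite PoszM dvdz_mul.
rewrite -!mul_conj.
have hc : edvd (d1 * nnorm dl)%N (conj v - r%:~R * conj u).
  have -> : conj v - r%:~R * conj u = conj (v - r%:~R * u).
    by rewrite conjB (conjM r%:~R) conj_intr.
  exact: edvd_conj.
have -> : conj u * (u * conj u) - conj v * (v * conj v) =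
  (v - r%:~R * u) * (- (conj v * conj v)) -
  (conj v - r%:~R * conj u) * (r%:~R * u * (conj v + r%:~R * conj u)) -
  (r ^+ 3 - 1)%:~R * (u * conj u * conj u) by ring.
apply: edvdB; last by apply: edvdMr; rewrite edvd_intr.
apply: edvdB; last exact: edvdMr.
exact: edvdMr.
Qed.

(** Otherwise N(A) = N(C), whereas these are coprime and N(A) > 1. *)
Lemma valid_norm_neq : norm u <> norm v.
Proof.
rewrite /u /v !normM norm_conj => h.
have n0 : norm et != 0 by rewrite -nnormE eqz_nat -lt0n; exact: sqfree_gt0 (sq_et V).
have {}h := mulfI n0 h.
have hA : nnorm A = nnorm C by rewrite /nnorm h.
have := co_C V; rewrite coprimeMr => /andP[_]; rewrite -hA /coprime gcdnn => /eqP h1.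
by have := A_gt1 V; rewrite h1.
Qed.

Lemma valid_norm_gt0 : norm v != 0.
Proof.
rewrite /v normM norm_conj -!nnormE mulf_eq0 !eqz_nat negb_or -!lt0n.
rewrite (sqfree_gt0 (sq_et V)) /= lt0n; apply/eqP => c0.
have := co_C V; rewrite coprimeMr => /andP[_]; rewrite c0 /coprime gcd0n => /eqP h1.
by have := A_gt1 V; rewrite h1.
Qed.

(** Modulo W, u conj v is conj w = -1 - w, whose om is -1. This is the purpose of taking C congruent
    to w rather than to 1. *)
Lemma valid_not_real : om (u * conj v) <> 0.
Proof.
move=> h.
have hW : edvd W (u * conj v - Eis (-1) (-1)).
  have -> : u * conj v - Eis (-1) (-1) = 
     (et - 1) * (et * A * conj C) + (et - 1) * (A * conj C) + (A - 1) * conj C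
     + conj (C - Eis 0 1).
    rewrite /u /v conjM conjK conjB.
    have -> : conj (Eis 0 1) = Eis (-1) (-1) by [].
    by ring.
  apply: edvdD; last by apply: edvd_conj; exact: C_W V.
  apply: edvdD; last by apply: edvdMr; exact: A_W V.
  by apply: edvdD; apply: edvdMr; exact: et_W V.
move: hW => /andP[_]; rewrite omD omN h /= add0r opprK dvdzE => /dvdn_leq.
by move/(_ isT); rewrite leqNgt (ltn_trans _ W2).
Qed.

Definition point_t := Eis
  (re (conj u * (norm u)%:~R - conj v * (norm v)%:~R) %/ m)%Z
  (om (conj u * (norm u)%:~R - conj v * (norm v)%:~R) %/ m)%Z.

Lemma point_tE :
  conj u * (norm u)%:~R - conj v * (norm v)%:~R = m%:Z%:~R * point_t.
Proof.
exact: edvd_div valid_nu_dvd.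
Qed.

Lemma m_gt0 : (0 < m)%N.
Proof.
rewrite /m !muln_gt0 (sqfree_gt0 (sq_et V)) (sqfree_gt0 (sq_d1 V)).
exact: sqfree_gt0 (sq_dl V).
Qed.

Lemma point_t_neq0 : point_t != 0.
Proof.
apply/eqP => t0; have := point_tE; rewrite t0 mulr0 => /eqP; rewrite subr_eq0 => /eqP h.
exact: valid_norm_neq (conj_norm_inj h).
Qed.

End Solution.

(** * Primitive solutions attached to the data *)

Definition vec (a b : eis) : 'rV[int]_4 :=
  \row_(i < 4) nth 0 [:: re a; om a; - re b; - om b] i.

Lemma vecE a b : [/\ vec a b 0 0 = re a, vec a b 0 1 = om a,
  vec a b 0 2 = - re b & vec a b 0 3 = - om b].
Proof. by rewrite /vec !mxE. Qed.

Definition gcdv (x : 'rV[int]_4) : nat := \big[gcdn/0%N]_(i < 4) absz (x 0 i).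
Definition prim (x : 'rV[int]_4) : 'rV[int]_4 := \row_i (x 0%R i %/ gcdv x)%Z.

Lemma primE (x : 'rV[int]_4) i : x 0 i = (gcdv x)%:Z * prim x 0 i.
Proof.
rewrite mxE mulrC divzK // dvdzE.
exact: (@biggcdn_inf _ i xpredT (fun i => absz (x 0 i))).
Qed.

Lemma gcdv_gt0 (x : 'rV[int]_4) i : x 0 i != 0 -> (0 < gcdv x)%N.
Proof. by rewrite lt0n; apply: contraNneq => g0; rewrite primE g0 mul0r. Qed.

Lemma prim_primitive x : (0 < gcdv x)%N -> primitive_vec (prim x).
Proof.
move=> g0; rewrite /primitive_vec.
suff h : gcdv x = (gcdv x * \big[gcdn/0%N]_(i < 4) absz (prim x 0%R i))%N.
  by apply/eqP; rewrite -(eqn_pmul2l g0) -h muln1.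
rewrite (big_endo (muln (gcdv x)) (muln_gcdr _) (muln0 _)) {1}/gcdv.
by apply: eq_bigr => i _; rewrite {1}primE abszM.
Qed.

Lemma prim_height x : (0 < gcdv x)%N -> (height (prim x) <= height x)%N.
Proof.
move=> g0; apply/bigmax_leqP => i _.
apply: leq_trans (_ : absz (x 0%R i) <= _)%N.
  by rewrite (primE x i) abszM leq_pmull.
exact: (@leq_bigmax _ (fun i : 'I_4 => absz (x 0 i)) i).
Qed.

Lemma prim_cubic x : (0 < gcdv x)%N -> on_fermat_cubic x -> on_fermat_cubic (prim x).
Proof.
move=> g0; rewrite /on_fermat_cubic !(primE x) => h.
have g1 : (gcdv x)%:Z ^+ 3 != 0 by rewrite expf_neq0 // eqz_nat -lt0n.
by apply: (mulfI g1); rewrite mulr0 -[RHS]h; ring.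
Qed.

Lemma prim_sum (x : 'rV[int]_4) i j : prim x 0 i + prim x 0 j = 0 -> x 0 i + x 0 j = 0.
Proof. by move=> h; rewrite !(primE x) -mulrDr h mulr0. Qed.

Lemma vec_solution (R : realType) (B : R) (M : nat) a b :
  re a ^+ 3 + om a ^+ 3 = re b ^+ 3 + om b ^+ 3 -> re a + om a <> 0 ->
  norm a <> norm b -> ebound M a -> ebound M b -> M%:R <= B ->
  solutions B (prim (vec a b)).
Proof.
move=> hc hl hn /andP[a1 a2] /andP[b1 b2] MB.
have [e0 e1 e2 e3] := vecE a b.
have g0 : (0 < gcdv (vec a b))%N.
  have [r0|r0] := eqVneq (re a) 0.
    apply: (@gcdv_gt0 _ 1); rewrite e1; apply/eqP => o0; apply: hl.
    by rewrite r0 o0.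
  by apply: (@gcdv_gt0 _ 0); rewrite e0.
split.
- exact: prim_primitive.
- by apply: prim_cubic => //; rewrite /on_fermat_cubic e0 e1 e2 e3 hc; ring.
- split=> -[/prim_sum h1 /prim_sum h2].
  + by apply: hl; rewrite -e0 -e1.
  + apply: hn; rewrite e0 e2 in h1; rewrite e1 e3 in h2.
    have r : re a = re b by apply/eqP; rewrite -subr_eq0; apply/eqP.
    have o : om a = om b by apply/eqP; rewrite -subr_eq0; apply/eqP.
    by rewrite /norm r o.
  + apply: hn; rewrite e0 e3 in h1; rewrite e1 e2 in h2.
    have r : re a = om b by apply/eqP; rewrite -subr_eq0; apply/eqP.
    have o : om a = re b by apply/eqP; rewrite -subr_eq0; apply/eqP.
    by rewrite /norm r o; ring.
apply: le_trans MB; rewrite ler_nat; apply: (leq_trans (prim_height g0)).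
apply/bigmax_leqP => i _; rewrite mxE -lez_nat abszE.
by case: i => -[|[|[|[|]]]] //= _; rewrite ?normrN.
Qed.

(** Both vectors are integer multiples of their common primitive vector, so the cross products
    agree. *)
Lemma prim_inj a b a' b' : prim (vec a b) = prim (vec a' b') -> a * b' = a' * b.
Proof.
move=> h; have [e0 e1 e2 e3] := vecE a b; have [f0 f1 f2 f3] := vecE a' b'.
move: e0 e1 e2 e3 f0 f1 f2 f3; rewrite !(primE (vec a b)) !(primE (vec a' b')) h.
move: (gcdv _)%:Z (gcdv _)%:Z (prim _ 0 0) (prim _ 0 1) (prim _ 0 2) (prim _ 0 3).
move=> g' g x y z t e0 e1 e2 e3 f0 f1 f2 f3.
have e2' : re b = - (g * z) by rewrite e2 opprK.
have e3' : om b = - (g * t) by rewrite e3 opprK.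
have f2' : re b' = - (g' * z) by rewrite f2 opprK.
have f3' : om b' = - (g' * t) by rewrite f3 opprK.
by apply: eis_eq; rewrite !eisE -e0 -e1 -f0 -f1 e2' e3' f2' f3'; ring.
Qed.

Lemma size_le_num_solutions (R : realType) (B : R) (s : seq 'rV[int]_4) :
  uniq s -> (forall x, x \in s -> solutions B x) ->
  (size s <= num_solutions B)%N.
Proof.
move=> us hs; rewrite /num_solutions.
have -> : size s = #|` [fset x in s]%fset|%fset.
  by rewrite card_fseq undup_id.
apply: fsubset_leq_card; apply/fsubsetP => x; rewrite inE /= => xs.
by rewrite in_fset_set ?inE; [exact: hs|exact: finite_solutions].
Qed.

Lemma PoszX (a n : nat) : (a ^ n)%N%:Z = a%:Z ^+ n.
Proof. by elim: n => // n IHn; rewrite expnS PoszM IHn exprS. Qed.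

Definition point_vec (d1 : nat) (dl et A C : eis) : 'rV[int]_4 :=
  let t := point_t d1 dl et A C in
  prim (vec (kap * (et * A * t)) (kap * (conj et * C * t))).

Lemma kap_neq0 : kap != 0. Proof. by []. Qed.

(** m times the point is bounded by 108 U^4, and dividing by m gives the height. The first line is
    excluded by [valid_not_real], the other two by [valid_norm_neq]. *)
Lemma point_vec_solution (R : realType) (B : R) (W P : nat) (d1 M : nat)
    (dl et A C : eis) (U : int) : (2 < W)%N ->
  valid W P d1 dl et A C -> ebound U (et * A) -> ebound U (conj et * C) ->
  108 * U ^+ 4 <= (nnorm et * (d1 * nnorm dl))%N%:Z * M%:Z -> M%:R <= B ->
  solutions B (point_vec d1 dl et A C).
Proof.
move=> W2 V bu bv hU MB; have hE := point_tE V.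
have m0 := m_gt0 V; set m := (nnorm et * _)%N in hU hE m0.
have mz : 0 < m%:Z by rewrite ltz_nat.
have [pb1 pb2] := point_bound (ltW mz) bu bv hE.
have scale z : ebound (108 * U ^+ 4) (m%:Z%:~R * z) -> ebound M z.
  rewrite /ebound reM omM re_intr om_intr !mul0r subr0 addr0 subr0 !normrM.
  rewrite (gtr0_norm mz) => /andP[h1 h2].
  by have := le_trans h1 hU; have := le_trans h2 hU; rewrite !ler_pM2l // => -> ->.
have t0 := point_t_neq0 V.
apply: (@vec_solution R B M) => //.
- by apply: point_cubic hE; rewrite gt_eqF.
- move/(point_om hE)/eqP; rewrite mulf_eq0 (negbTE (valid_norm_gt0 V)) orbF.
  by move/eqP; exact: valid_not_real V.
- rewrite normM normM [norm (kap * _)]normM [norm (conj et * C * _)]normM.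
  have k0 : norm kap != 0 by [].
  move=> /(mulfI k0) h; apply: (valid_norm_neq V).
  have n0 : norm (point_t d1 dl et A C) != 0.
    by apply: contra_neq t0; exact: norm_eq0.
  exact: mulIf n0 _ _ h.
- exact: scale.
- exact: scale.
Qed.

(** Equal points have equal cross products; cancelling kap^2 t t' leaves the hypothesis of
    [valid_inj]. *)
Lemma point_vec_inj (W P : nat) d1 d1' dl dl' et et' A A' C C' :
  (2 < W)%N -> (3 %| W)%N ->
  valid W P d1 dl et A C -> valid W P d1' dl' et' A' C' ->
  point_vec d1 dl et A C = point_vec d1' dl' et' A' C' ->
  [/\ d1 = d1', dl = dl', et = et', A = A' & C = C'].
Proof.
move=> W2 W3 V V' /prim_inj h; apply: (valid_inj W2 W3 V V').
set t := point_t d1 dl et A C in h; set t' := point_t d1' dl' et' A' C' in h.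
have kt : kap * kap * (t * t') != 0.
  apply/eqP => /eis_mulf_eq0[/eis_mulf_eq0[]/eqP|/eis_mulf_eq0[]/eqP].
  - by rewrite (negbTE kap_neq0).
  - by rewrite (negbTE kap_neq0).
  - by rewrite (negbTE (point_t_neq0 V)).
  by rewrite (negbTE (point_t_neq0 V')).
apply: (eis_mulfI kt).
transitivity (kap * (et * A * t) * (kap * (conj et' * C' * t'))); first by ring.
by rewrite h; ring.
Qed.

(** * Points attached to a box *)

Section BoxPoints.
Variables (W P : nat).
Hypotheses (W2 : (2 < W)%N) (W3 : (3 %| W)%N).

(* [theta X1 X2 X3 * K ^ 4] bounds the height of the points of a box. *)
Definition theta X1 X2 X3 := (2 ^ 17 * 3 ^ 5 * W ^ 6 * X3 ^ 2 * dmax W X1 X2 ^ 3)%N.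

Definition box_vec X1 X2 X3 K (t : box W X1 X2 X3 K) :=
  point_vec (box_d1 t) (box_dl t) (box_et t) (box_A t) (box_C t).

Lemma blk_ebound (L : nat) (t : 'I_L * 'I_L) : ebound (2 * (W%:Z * L%:Z)) (blk W t).
Proof.
have W0 : (0 < W)%N by exact: ltn_trans W2.
have [h1 h2 h3 h4] := blk_coords W0 t.
have h0 : 0 <= W%:Z * L%:Z by rewrite mulr_ge0.
by apply/andP; split; rewrite ger0_norm //; move: h0 h1 h2 h3 h4; clear; lia.
Qed.

Lemma box_vec_solution (R : realType) (B : R) X1 X2 X3 K (t : box W X1 X2 X3 K) :
  box_valid P t -> (theta X1 X2 X3 * K ^ 4)%N%:R <= B -> solutions B (box_vec t).
Proof.
move=> /asboolP V hB; have W0 : (0 < W)%N by exact: ltn_trans W2.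
pose E : int := 2 * (W%:Z * X3%:Z); pose H : int := (sideC W X1 X2 K)%:Z.
have bE : ebound E (box_et t) by exact: blk_ebound.
have bA : ebound (2 * H) (box_A t).
  have := blk_ebound t.1.2; rewrite /E /H /sideC /sideA !PoszM => h.
  by have -> : 2 * (W%:Z * (dmax W X1 X2)%:Z * K%:Z) =
    2 * (W%:Z * ((dmax W X1 X2)%:Z * K%:Z)) by ring.
have bC : ebound H (box_C t).
  by rewrite /ebound /H /=; have := ltn_ord t.2.1; have := ltn_ord t.2.2; clear; lia.
have bu : ebound (6 * E * H) (box_et t * box_A t).
  have -> : 6 * E * H = 3 * E * (2 * H) by ring.
  exact: eboundM.
have bv : ebound (6 * E * H) (conj (box_et t) * box_C t).
  have -> : 6 * E * H = 3 * (2 * E) * H by ring.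
  exact: eboundM (ebound_conj bE) bC.
apply: (point_vec_solution W2 V bu bv) hB.
have [n1 _] := blk_norm W0 t.1.1.2; have [e1 _] := blk_norm W0 t.1.1.1.2.
have [d1 _] := lin_blk_bounds W0 t.1.1.1.1.
rewrite -/(box_et t) -/(box_dl t) -/(box_d1 t) in n1 e1 d1.
move: n1 e1 d1; move: (nnorm _) (nnorm _) (box_d1 t) => e n d n1 e1 d1.
(* A lower bound for the divisor m = n d1 e of nu, which is the gain in height. *)
have key : (9 * (W ^ 5 * X1 * X2 ^ 2 * X3 ^ 2) <= 16 * (n * (d * e)))%N.
  apply: leq_trans (_ : 3 * (W * X3) ^ 2 * (W * X1 * (3 * (W * X2) ^ 2)) <= _)%N.
    by apply: eq_leq; ring.
  apply: leq_trans (leq_mul n1 (leq_mul d1 e1)) _.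
  by apply: eq_leq; ring.
pose Un := (6 * (2 * (W * X3)) * sideC W X1 X2 K)%N.
have -> : 6 * E * H = Un%:Z by rewrite /E /H /Un !PoszM.
have -> : 108 * Un%:Z ^+ 4 = (108 * Un ^ 4)%N%:Z by rewrite PoszM PoszX.
rewrite -PoszM lez_nat -(leq_pmul2l (isT : 0 < 16)%N) [leqRHS]mulnA.
refine (leq_trans _ (leq_mul key (leqnn (theta X1 X2 X3 * K ^ 4)))).
(* [theta] is defined to make this an equality: 16 * 108 * 12^4 = 2^14 3^7, and dmax = 8 W^3 X1
   X2^2. *)
by apply: eq_leq; rewrite /Un /sideC /theta /dmax; ring.
Qed.

Lemma box_vec_inj X1 X2 X3 K X1' X2' X3' K' (t : box W X1 X2 X3 K)
    (t' : box W X1' X2' X3' K') :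
  box_valid P t -> box_valid P t' -> box_vec t = box_vec t' ->
  [/\ box_d1 t = box_d1 t', box_dl t = box_dl t', box_et t = box_et t',
    box_A t = box_A t' & box_C t = box_C t'].
Proof. by move=> /asboolP V /asboolP V'; exact: point_vec_inj V V'. Qed.

(** The number lies in [2^h, 2^(h+1)), so h is its binary logarithm. *)
Lemma exp2_shift_inj (h h' : nat) (x : 'I_(2 ^ h)) (x' : 'I_(2 ^ h')) :
  (2 ^ h + x = 2 ^ h' + x')%N -> h = h'.
Proof.
have bnd k (y : 'I_(2 ^ k)) : trunc_log 2 (2 ^ k + y) = k.
  apply: trunc_log_eq => //; rewrite leq_addr /= expnS mul2n -addnn ltn_add2l.
  exact: ltn_ord.
by move=> e; rewrite -(bnd h x) -(bnd h' x') e.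
Qed.

Lemma lin_blk_inj L L' (x : 'I_L) (x' : 'I_L') :
  lin_blk W x = lin_blk W x' -> (L + x = L' + x')%N.
Proof.
have W0 : (0 < W)%N by exact: ltn_trans W2.
by rewrite /lin_blk => /addnI /eqP; rewrite eqn_pmul2l // => /eqP.
Qed.

Lemma blk_inj L L' (t : 'I_L * 'I_L) (t' : 'I_L' * 'I_L') :
  blk W t = blk W t' -> (L + t.1 = L' + t'.1)%N /\ t.2 = t'.2 :> nat.
Proof.
have W0 : W%:Z != 0 by rewrite eqz_nat -lt0n; exact: ltn_trans W2.
move=> e.
have h1 : 1 + W%:Z * L%:Z + W%:Z * t.1%:Z = 1 + W%:Z * L'%:Z + W%:Z * t'.1%:Z.
  by have := congr1 re e.
have h2 : 0 + W%:Z * t.2%:Z = 0 + W%:Z * t'.2%:Z by have := congr1 om e.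
rewrite !add0r in h2; have := mulfI W0 h2 => -[h3]; split=> //.
rewrite -!addrA in h1; have := addrI _ h1; rewrite -!mulrDr => /(mulfI W0).
by rewrite -!PoszD => -[].
Qed.

Lemma box_vec_box_inj X1 X2 X3 K (t t' : box W X1 X2 X3 K) :
  box_valid P t -> box_valid P t' -> box_vec t = box_vec t' -> t = t'.
Proof.
move=> V V' h; have [e1 e2 e3 e4 e5] := box_vec_inj V V' h.
case: t t' {V V' h} e1 e2 e3 e4 e5 => [[[[x [y z]] [a b]] [c d]] [e f]].
case=> [[[[x' [y' z']] [a' b']] [c' d']] [e' f']].
rewrite /box_d1 /box_dl /box_et /box_A /box_C /= => /lin_blk_inj /addnI e1.
move=> /blk_inj[/= /addnI h1 h2] /blk_inj[/= /addnI h3 h4] /blk_inj[/= /addnI h5 h6].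
move=> -[h7 h8].
by do ![congr (_, _)]; apply: val_inj.
Qed.

(** The dyadic sizes are read off from d1, dl and eta, so different boxes share no point and their
    counts add up. *)
Lemma box_vec_disjoint (h1 h2 h3 h1' h2' h3' K K' : nat)
    (t : box W (2 ^ h1) (2 ^ h2) (2 ^ h3) K)
    (t' : box W (2 ^ h1') (2 ^ h2') (2 ^ h3') K') :
  box_valid P t -> box_valid P t' -> box_vec t = box_vec t' ->
  [/\ h1 = h1', h2 = h2' & h3 = h3'].
Proof.
move=> V V' h; have [e1 e2 e3 _ _] := box_vec_inj V V' h; split.
- exact: exp2_shift_inj (lin_blk_inj e1).
- exact: exp2_shift_inj (blk_inj e2).1.
exact: exp2_shift_inj (blk_inj e3).1.
Qed.

End BoxPoints.

(** * Summation over dyadic boxes *)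

Lemma flatten_map_uniq (I T : eqType) (f : I -> seq T) (s : seq I) :
  uniq s -> (forall i, i \in s -> uniq (f i)) ->
  (forall i j x, i \in s -> j \in s -> x \in f i -> x \in f j -> i = j) ->
  uniq (flatten (map f s)).
Proof.
elim: s => //= i s IHs /andP[is_ us] uf disj; rewrite cat_uniq uf ?mem_head //=.
apply/andP; split; last first.
  apply: IHs => // [j js|j k x js ks]; first by apply: uf; rewrite inE js orbT.
  by apply: disj; rewrite inE ?js ?ks orbT.
apply/hasPn => x /flattenP[y /mapP[j js ->] xj]; apply/negP => xi.
have ij : i = j by apply: (disj i j x) => //; rewrite inE ?eqxx ?js ?orbT.
by rewrite ij js in is_.
Qed.

Lemma size_flatten_map_ge (I T : eqType) (f : I -> seq T) (s : seq I) (k b : nat) :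
  (forall i, i \in s -> (b <= k * size (f i))%N) ->
  (size s * b <= k * size (flatten (map f s)))%N.
Proof.
elim: s => [|i s IHs] h //=; rewrite size_cat mulSn mulnDr leq_add //.
  by apply: h; rewrite mem_head.
by apply: IHs => j js; apply: h; rewrite inE js orbT.
Qed.

(** The integer part of the fourth root of B / c; for c > 0 the search succeeds at the latest at
    B. *)
Definition root4 (c B : nat) : nat :=
  find (fun k => (B < c * k.+1 ^ 4)%N) (iota 0 B.+1).

Lemma root4P (c B : nat) : (0 < c)%N ->
  (c * root4 c B ^ 4 <= B < c * (root4 c B).+1 ^ 4)%N.
Proof.
move=> c0; rewrite /root4; set a := (fun k => _); set k := find a _.
have hs : has a (iota 0 B.+1).
  apply/hasP; exists B; first by rewrite mem_iota leq0n add0n ltnSn.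
  apply: leq_trans (leq_pmull _ c0); rewrite -[X in (X <= _)%N]expn1.
  exact: leq_pexp2l.
have kB : (k < B.+1)%N by have := hs; rewrite has_find size_iota.
have := nth_find 0%N hs; rewrite -/k nth_iota // add0n => ak.
apply/andP; split; last exact: ak.
case: (posnP k) => [->|k0]; first by rewrite exp0n // muln0.
have k1 : (k.-1 < k)%N by rewrite prednK.
have := before_find 0%N k1; rewrite nth_iota; last by exact: ltn_trans kB.
by rewrite add0n /a prednK // => /negbT; rewrite -leqNgt.
Qed.

Lemma exists_modulus (n : nat) : (2 < n)%N -> exists W : nat,
  [/\ (2 < W)%N, (3 %| W)%N & forall p, prime p -> coprime p W -> (n < p)%N].
Proof.
move=> n2; exists n`!; split.
- apply: (leq_trans n2); rewrite -{1}(prednK (ltnW (ltnW n2))) -(prednK (ltnW (ltnW n2))).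
  by rewrite factS leq_pmulr ?fact_gt0.
- by apply: dvdn_fact.
move=> p pp cp; rewrite ltnNge; apply/negP => pn.
have pf : (p %| n`!)%N by apply: dvdn_fact; rewrite prime_gt0.
exact: (prime_coprime_absurd pp cp (dvdnn p) pf).
Qed.

Lemma linear_le_exp2 J : (22 <= J)%N -> (2 ^ 16 * J <= 2 ^ J)%N.
Proof.
move=> hJ; rewrite -(subnKC hJ); move: (J - 22)%N => m.
have -> : (2 ^ (22 + m) = 2 ^ 16 * (2 ^ 6 * 2 ^ m))%N by rewrite -!expnD.
rewrite leq_mul2l; apply/orP; right; have := ltn_expl m (isT : 1 < 2)%N.
by rewrite [(2 ^ 6)%N]/=; move: (2 ^ m)%N; clear; lia.
Qed.

Lemma exp2_15_ge (R : realFieldType) : 200 * 100 <= (2 ^ 15)%N%:R :> R.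
Proof. by rewrite (natrX R 2 15); lra. Qed.

Lemma exp2_16_ge (R : realFieldType) (n : nat) :
  4 * 100 * (124%:R * n%:R) <= (2 ^ 16)%N%:R * n%:R :> R.
Proof. by have := ler0n R n; rewrite (natrX R 2 16); lra. Qed.

Section LowerBound.
Variables (R : realType) (P0 W w : nat).
Hypotheses (P0_gt0 : (0 < P0)%N) (P0r : (P0%:R : R)^-1 <= 1 / (40 * 100))
  (W2 : (2 < W)%N) (W3 : (3 %| W)%N)
  (P0W : forall p, prime p -> coprime p W -> (P0 < p)%N)
  (Ww : (W <= 2 ^ w)%N).
Variables (B : R) (Bn J : nat).
Hypotheses (BnB : Bn%:R <= B) (J_big : (100 + 20 * w <= J)%N)
  (Bn_ge : (2 ^ (50 * J) <= Bn)%N) (Bn_lt : (Bn < 2 ^ (50 * J.+1))%N).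

(** Bounds [dmax] for all exponents h1, h2 <= 2 J. Being the same for all boxes, it lets [valid_inj]
    compare data from different ones. *)
Let P := (2 ^ (3 + 3 * w + 6 * J))%N.
(** 512 is 16 from (K + 1)^4 <= 16 K^4 times 32 from [box_count]; the rest is the ratio of theta K^4
    to X1 X2^2 X3^2 sideA^2 K^2. *)
Definition box_const := (512 * (8 * W ^ 3 * (2 ^ 17 * 3 ^ 5 * W ^ 6)))%N.

Let W_gt0 : (0 < W)%N. Proof. exact: ltn_trans W2. Qed.
Let exp2_mono a b : (a <= b)%N -> (2 ^ a <= 2 ^ b)%N.
Proof. by move=> ab; exact: leq_pexp2l. Qed.

Section OneBox.
Variables h1 h2 h3 : nat.
Hypotheses (J1 : (J <= h1 <= 2 * J)%N) (J2 : (J <= h2 <= 2 * J)%N)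
  (J3 : (J <= h3 <= 2 * J)%N).
Let X1 := (2 ^ h1)%N.
Let X2 := (2 ^ h2)%N.
Let X3 := (2 ^ h3)%N.

Lemma dmax_le : (dmax W X1 X2 <= P)%N.
Proof.
rewrite /dmax.
have e1 : (W ^ 3 <= 2 ^ (3 * w))%N by rewrite mulnC expnM leq_exp2r.
apply: leq_trans (_ : 2 ^ 3 * 2 ^ (3 * w) * 2 ^ h1 * (2 ^ h2) ^ 2 <= _)%N.
  by rewrite !leq_mul.
by rewrite -expnM -!expnD exp2_mono //; move: J1 J2; clear; lia.
Qed.

Let K := root4 (theta W X1 X2 X3) Bn.

Lemma theta_le : (theta W X1 X2 X3 <= 2 ^ (34 + 15 * w + 22 * J))%N.
Proof.
rewrite /theta.
have e1 : (W ^ 6 <= 2 ^ (6 * w))%N by rewrite mulnC expnM leq_exp2r.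
have e2 : (dmax W X1 X2 ^ 3 <= 2 ^ ((3 + 3 * w + 6 * J) * 3))%N.
  by rewrite expnM leq_exp2r // dmax_le.
have e3 : (3 ^ 5 <= 2 ^ 8)%N by [].
have e4 : (X3 ^ 2 <= 2 ^ (4 * J))%N.
  by rewrite /X3 -expnM exp2_mono //; move: J3; clear; lia.
apply: leq_trans (_ : 2 ^ 17 * 2 ^ 8 * 2 ^ (6 * w) * 2 ^ (4 * J) *
   2 ^ ((3 + 3 * w + 6 * J) * 3) <= _)%N.
  exact: (leq_mul (leq_mul (leq_mul (leq_mul (leqnn _) e3) e1) e4) e2).
by rewrite -!expnD exp2_mono //; clear; lia.
Qed.

Lemma theta_gt0 : (0 < theta W X1 X2 X3)%N.
Proof.
by rewrite /theta /dmax !(muln_gt0, expn_gt0) W_gt0.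
Qed.

(** If K < P, then theta (K + 1)^4 would be at most 2^(46 J + 27 w + 46), which is at most 2^(50 J)
    <= Bn. This accounts for the factor 50. *)
Lemma P_le_K : (P <= K)%N.
Proof.
have /andP[_ h] := root4P Bn theta_gt0; rewrite -/K in h.
rewrite leqNgt; apply/negP => KP.
have : (theta W X1 X2 X3 * K.+1 ^ 4 <= Bn)%N.
  apply: leq_trans Bn_ge.
  apply: leq_trans (_ : 2 ^ (34 + 15 * w + 22 * J) * 2 ^ ((3 + 3 * w + 6 * J) * 4) <= _)%N.
    by rewrite leq_mul ?theta_le // expnM leq_exp2r.
  by rewrite -expnD exp2_mono //; move: J_big; clear; lia.
by rewrite leqNgt h.
Qed.

Definition box_seq : seq 'rV[int]_4 :=
  [seq box_vec t | t <- enum (box_valid (W := W) (X1 := X1) (X2 := X2) (X3 := X3)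
     (K := K) P)].

Lemma box_seq_uniq : uniq box_seq.
Proof.
rewrite map_inj_in_uniq ?enum_uniq // => t t'; rewrite !mem_enum => V V'.
exact: box_vec_box_inj V V'.
Qed.

Lemma box_seq_solution x : x \in box_seq -> solutions B x.
Proof.
move=> /mapP[t]; rewrite mem_enum => V ->.
apply: (box_vec_solution W2 V); apply: le_trans BnB; rewrite ler_nat.
by have /andP[] := root4P Bn theta_gt0.
Qed.

(** The height bound theta K^4 is also, up to a constant, the number of candidates in the box; so
    every box yields a constant times B points, whatever h1, h2, h3. *)
Lemma box_seq_size : (Bn <= box_const * size box_seq)%N.
Proof.
rewrite /box_seq size_map -cardE.
have /andP[_ hB] := root4P Bn theta_gt0; rewrite -/K in hB.
(* [box_count] is applied with D = 2^J and l = 124 J. *)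
have D_gt0 : (0 < 2 ^ J)%N by rewrite expn_gt0.
have K0 : (0 < K)%N by apply: leq_trans P_le_K; rewrite expn_gt0.
have WD : (200 * 100 * W%:R : R) <= (2 ^ J)%N%:R.
  have : (2 ^ 15 * W <= 2 ^ J)%N.
    apply: leq_trans (_ : 2 ^ 15 * 2 ^ w <= _)%N; first by rewrite leq_mul2l Ww orbT.
    by rewrite -expnD exp2_mono //; move: J_big; clear; lia.
  rewrite -(ler_nat R) (natrM R (2 ^ 15)); apply: le_trans; apply: ler_wpM2r.
    exact: ler0n.
  exact: exp2_15_ge.
have lD : (4 * 100 * (124 * J)%N%:R : R) <= (2 ^ J)%N%:R.
  have : (2 ^ 16 * J <= 2 ^ J)%N.
    by apply: linear_le_exp2; move: J_big; clear; lia.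
  rewrite -(ler_nat R) (natrM R (2 ^ 16)) (natrM R 124); apply: le_trans.
  exact: exp2_16_ge.
have DX k : (J <= k <= 2 * J)%N -> (2 ^ J <= 2 ^ k)%N.
  by move=> /andP[h _]; exact: exp2_mono.
have KB : (K <= 2 ^ (50 * J.+1))%N.
  apply: leq_trans (ltnW Bn_lt); have /andP[h _] := root4P Bn theta_gt0.
  apply: leq_trans h; rewrite -/K; apply: leq_trans (leq_pmull _ theta_gt0).
  by rewrite -[X in (X <= _)%N]expn1; exact: leq_pexp2l.
(* The left side is at most 2^(122 J + 13 w + 113), and 2 J exceeds the remaining 13 w + 113. *)
have lbig : (dmax W X1 X2 * (2 * W * X3) ^ 2 * (2 * W * sideA W X1 X2 K) ^ 2
    < 2 ^ (124 * J).+1)%N.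
  rewrite /sideA.
  have e1 : ((2 * W * X3) ^ 2 <= (2 ^ 1 * 2 ^ w * 2 ^ (2 * J)) ^ 2)%N.
    by rewrite leq_exp2r // !leq_mul // exp2_mono //; case/andP: J3.
  have e2 : ((2 * W * (dmax W X1 X2 * K)) ^ 2 <=
      (2 ^ 1 * 2 ^ w * (P * 2 ^ (50 * J.+1))) ^ 2)%N.
    rewrite leq_exp2r //.
    exact: (leq_mul (leq_mul (leqnn 2) Ww) (leq_mul dmax_le KB)).
  apply: leq_ltn_trans (leq_mul (leq_mul dmax_le e1) e2) _.
  rewrite /P -!expnD -!expnM -!expnD ltn_exp2l //.
  by move: J_big; clear; lia.
have := box_count P0_gt0 P0r W2 W3 P0W D_gt0 WD lD (DX _ J1) (DX _ J2) (DX _ J3)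
  dmax_le P_le_K lbig.
rewrite -/X1 -/X2 -/X3; move: (#|_|) => N hN.
have h16 : (K.+1 ^ 4 <= 16 * K ^ 4)%N.
  rewrite (_ : 16 * K ^ 4 = (2 * K) ^ 4)%N; last by rewrite expnMn.
  by rewrite leq_exp2r //; move: K0; clear; lia.
apply: leq_trans (ltnW hB) _.
apply: leq_trans (_ : theta W X1 X2 X3 * (16 * K ^ 4) <= _)%N.
  by rewrite leq_mul2l h16 orbT.
apply: leq_trans (_ : 16 * (8 * W ^ 3 * (2 ^ 17 * 3 ^ 5 * W ^ 6)) * (32 * N) <= _)%N.
  refine (leq_trans _ (leq_mul (leqnn _) hN)).
  by apply: eq_leq; rewrite /theta /sideA /dmax; ring.
by apply: eq_leq; rewrite /box_const; ring.
Qed.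

End OneBox.

Lemma num_solutions_ge : (J ^ 3 * Bn <= box_const * num_solutions B)%N.
Proof.
(* The J^3 triples of exponents in [J, 2 J) supply the factor (log B)^3. *)
pose idx := [seq (t.1.1 + J, t.1.2 + J, t.2 + J)%N | t : 'I_J * 'I_J * 'I_J].
have idxP t : t \in idx -> [/\ (J <= t.1.1 <= 2 * J)%N, (J <= t.1.2 <= 2 * J)%N &
    (J <= t.2 <= 2 * J)%N].
  move=> /mapP[[[a b] c] _ ->] /=.
  by split; rewrite leq_addl /= mul2n -addnn leq_add2r ltnW.
have idxU : uniq idx.
  rewrite map_inj_uniq ?enum_uniq // => -[[a b] c] [[a' b'] c'] /= [].
  by move=> /addIn/val_inj -> /addIn/val_inj -> /addIn/val_inj ->.
have sz : size idx = (J ^ 3)%N.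
  by rewrite size_map -cardE !card_prod !card_ord !expnS expn0 muln1 mulnA.
pose f (t : nat * nat * nat) := box_seq t.1.1 t.1.2 t.2.
rewrite -sz; apply: leq_trans (_ : box_const * size (flatten (map f idx)) <= _)%N.
  apply: size_flatten_map_ge => t /idxP[? ? ?]; exact: box_seq_size.
rewrite leq_mul2l; apply/orP; right; apply: size_le_num_solutions.
  apply: flatten_map_uniq => //.
    by move=> t _; exact: box_seq_uniq.
  move=> [[a b] c] [[a' b'] c'] x _ _ /mapP[t + ->] /mapP[t' + e].
  rewrite !mem_enum => V V'; have [] := box_vec_disjoint W2 W3 V V' e.
  by move=> /= -> -> ->.
by move=> x /flattenP[s /mapP[t _ ->]]; exact: box_seq_solution.
Qed.

End LowerBound.

(** * Small B and the final constant *)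

Lemma num_solutions_gt0 (R : realType) (B : R) : 6 <= B -> (0 < num_solutions B)%N.
Proof.
(* 3^3 + 4^3 + 5^3 = 6^3 has height exactly 6. *)
move=> B6; apply: (@size_le_num_solutions R B [:: prim (vec (Eis 3 4) (Eis (-5) 6))]).
  by [].
by move=> x; rewrite inE => /eqP ->; exact: (@vec_solution R B 6).
Qed.

Lemma ln_le_exp2 (R : realType) (B : R) (m : nat) :
  0 < B -> B <= (2 ^ m)%N%:R -> ln B <= m%:R.
Proof.
move=> B0 hB; have two0 : (0 : R) < 2 by [].
apply: le_trans (_ : ln ((2 : R) ^+ m) <= _).
  by rewrite ler_ln ?posrE ?exprn_gt0 // -natrX.
rewrite lnXn // -[leRHS]mulr1 [leRHS]mulr_natl ler_wMn2r //.
have -> : (2 : R) = 1 + 1 by rewrite -natr1.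
by apply: le_ln1Dx; rewrite (lt_trans _ ltr01) // oppr_lt0.
Qed.

Theorem theorem1p1 (R : realType) :
  exists c : R, 0 < c /\
    forall B : R, 6 <= B -> c * (B * ln B ^+ 3) <= (num_solutions B)%:R.
Proof.
have [n [n_gt2 nr]] : exists n : nat, (2 < n)%N /\ ((n%:R : R)^-1 <= 1 / (40 * 100)).
  by exists (40 * 100)%N; rewrite natrM div1r.
have n_gt0 : (0 < n)%N by exact: ltn_trans n_gt2.
have [W [W2 W3 nW]] := exists_modulus n_gt2.
have Ww : (W <= 2 ^ W)%N by exact: ltnW (ltn_expl _ _).
pose J0 := (100 + 20 * W)%N.
(* S bounds B (ln B)^3 when J < J0, where one solution suffices. T serves J >= J0, with B <= 2 Bn
   and ln B <= 100 J. *)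
pose S : R := (2 ^ (50 * J0))%N%:R * (50 * J0)%N%:R ^+ 3.
pose T : R := 2 * 100 ^+ 3 * (box_const W)%:R.
have J0_gt0 : (0 < J0)%N by [].
have S0 : 0 < S by rewrite mulr_gt0 ?exprn_gt0 ?ltr0n ?expn_gt0 ?muln_gt0.
have T0 : 0 <= T by rewrite !mulr_ge0 // exprn_ge0.
have ST0 : 0 < S + T by rewrite ltr_wpDr.
exists (S + T)^-1; split; first by rewrite invr_gt0.
move=> B B6; have B1 : 1 <= B by apply: le_trans B6; rewrite ler1n.
have B0 : 0 < B by exact: lt_le_trans B1.
have lnB : 0 <= ln B by exact: ln_ge0.
rewrite ler_pdivrMl //.
pose Bn := Num.truncn B.
have /andP[Bn1 Bn2] := truncn_itv (ltW B0); rewrite -/Bn in Bn1 Bn2.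
have Bn_gt0 : (0 < Bn)%N by rewrite truncn_gt0.
(* 50 J is the binary logarithm of Bn rounded down to a multiple of 50. *)
pose J := (trunc_log 2 Bn %/ 50)%N.
have hBn_ge : (2 ^ (50 * J) <= Bn)%N.
  apply: leq_trans (trunc_logP (isT : 1 < 2)%N Bn_gt0); apply: leq_pexp2l => //.
  by rewrite mulnC leq_trunc_div.
have hBn_lt : (Bn < 2 ^ (50 * J.+1))%N.
  apply: leq_trans (trunc_log_ltn Bn (isT : 1 < 2)%N) _; apply: leq_pexp2l => //.
  by rewrite mulnC; exact: ltn_ceil.
have BJ : B <= (2 ^ (50 * J.+1))%N%:R by apply: le_trans (ltW Bn2) _; rewrite ler_nat.
have lnJ := ln_le_exp2 B0 BJ.
have N0 : (0 : R) <= (num_solutions B)%:R by exact: ler0n.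
have [JJ|JJ] := leqP J0 J.
  have key := num_solutions_ge n_gt0 nr W2 W3 nW Ww Bn1 JJ hBn_ge hBn_lt.
  rewrite mulrDl; apply: le_trans (_ : T * (num_solutions B)%:R <= _); last first.
    by rewrite lerDr mulr_ge0 // ltW.
  have J1 : (0 < J)%N by exact: leq_trans JJ.
  have l3 : ln B ^+ 3 <= (100 * J%:R) ^+ 3.
    rewrite lerXn2r ?nnegrE ?mulr_ge0 //; apply: (le_trans lnJ).
    have -> : 100 * J%:R = (100 * J)%N%:R :> R by rewrite natrM.
    by rewrite ler_nat; move: J1; clear; lia.
  have B2 : B <= 2 * Bn%:R.
    apply: (le_trans (ltW Bn2)); rewrite -natr1.
    have : (1 : R) <= Bn%:R by rewrite ler1n.
    by move: (Bn%:R : R) => x; clear; lra.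
  have := ler_pM (ltW B0) (exprn_ge0 3 lnB) B2 l3 => /le_trans; apply.
  have -> : 2 * Bn%:R * (100 * J%:R) ^+ 3 = 2 * 100 ^+ 3 * (J%:R ^+ 3 * Bn%:R) :> R.
    by rewrite exprMn; ring.
  rewrite /T -[leRHS]mulrA; apply: ler_wpM2l; first by rewrite mulr_ge0 // exprn_ge0.
  by rewrite -natrX -!natrM ler_nat.
apply: le_trans (_ : S * (num_solutions B)%:R <= _); last first.
  by rewrite mulrDl lerDl mulr_ge0.
apply: le_trans (_ : S <= _); last first.
  by rewrite ler_peMr ?ler1n ?num_solutions_gt0 // ltW.
apply: ler_pM; rewrite ?exprn_ge0 // ?(ltW B0) //.
  apply: (le_trans BJ); rewrite ler_nat; apply: leq_pexp2l => //.
  by rewrite leq_mul2l JJ.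
rewrite lerXn2r ?nnegrE //; apply: (le_trans lnJ).
by rewrite ler_nat leq_mul2l JJ.
Qed.
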